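(* Let $\beta\in B_n$ satisfy $b_{\min}(\beta)=1+M-m=3$ and $\zeta=\deg_zP_{\widehat\beta}>1-\mu$, where $\mu=\mu(\widehat\beta)$. Let $x=\min\deg_vP_{\widehat\beta}$, $y=\deg_vP_{\widehat\beta}$. Write (i) $h_m=a_\zeta z^\zeta+a_{\zeta-2}z^{\zeta-2}+\cdots+a_{1-\mu}z^{1-\mu}$, (ii) $h_{m+1}=b_\zeta z^\zeta+b_{\zeta-2}z^{\zeta-2}+\cdots+b_{1-\mu}z^{1-\mu}$, (iii) $h_{m+2}=c_\zeta z^\zeta+c_{\zeta-2}z^{\zeta-2}+\cdots+c_{1-\mu}z^{1-\mu}$, and set $a_k=b_k=c_k=0$ for $k\notin[1-\mu,\zeta]$. Then $\mu\le3$ and $\zeta\ge0$. $P_{\widehat\beta}$ is determined by $\zeta$, $x$, any one proper $h_J$ ($J\in\{m,m+1,m+2\}$), and $J-m$, as described below. If $\mu=3$, then $P_{-2}(v)=v^{x}(1-v^2)^2$. Case I ($\zeta\ge x\ge-2$): $c_\zeta=0$. If $c_{\zeta-2}=0$, then $\zeta=x$, $a_\zeta=1$, $a_{\zeta-2}=\zeta$ and $b_\zeta=0$. If $\mu=2$, then $P_{-1}(v)=v^{x}\{1+c_{-1}-(1+2c_{-1})v^2+c_{-1}v^4\}$. For all integers $j$, $$a_{\zeta-2j}=\binom{\frac{\zeta+x}{2}+1-j}{\,j-\frac{\zeta-x}{2}\,}+c_{\zeta-2j},$$ $$b_{\zeta-2j}=-\binom{\frac{\zeta+x}{2}-j}{\,j-1-\frac{\zeta-x}{2}\,}-2c_{\zeta-2j}-c_{\zeta-2-2j}\quad\text{if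 }x\ge0,$$ $$b_{\zeta-2j}=(-1)^{x}\,\delta_{j,\lfloor(1+\zeta)/2\rfloor}-2c_{\zeta-2j}-c_{\zeta-2-2j}\quad\text{if }x\in\{-1,-2\}.$$ Case II ($\zeta\ge-y\ge-2$; the mirror images of the braids in Case I): for all integers $j$, $$b_{\zeta-2j}=-(-1)^{y}\binom{\frac{\zeta-y}{2}-j}{\,j-1-\frac{\zeta+y}{2}\,}-2a_{\zeta-2j}-a_{\zeta-2-2j}\quad\text{if }y\le0,$$ $$b_{\zeta-2j}=\delta_{j,\lfloor(1+\zeta)/2\rfloor}-2a_{\zeta-2j}-a_{\zeta-2-2j}\quad\text{if }y\in\{1,2\},$$ $$c_{\zeta-2j}=(-1)^{y}\binom{\frac{\zeta-y}{2}+1-j}{\,j-\frac{\zeta+y}{2}\,}+a_{\zeta-2j}.$$ Cases I and II cover all possibilities. In each case the relations may be manipulated so that the independent coefficients are the $a_k$, or the $b_k$, or the $c_k$ (i.e. the coefficients of any one of the three families determine the other two).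
   Context: $B_n$ is the braid group on $n$ strands with standard generators $\sigma_1,\dots,\sigma_{n-1}$; $\widehat\beta$ is the oriented link obtained by the standard closure of $\beta$, and $\mu(\widehat\beta)$ is its number of components; $w=w(\beta)$ is the exponent sum (writhe) of $\beta$. The Homflypt polynomial $P_L(v,z)$ of an oriented link $L$ is determined by $P=1$ on the unknot and $P_{D_+}=vz\,P_{D_0}+v^2P_{D_-}$ for diagrams differing at one crossing (positive, smoothed, negative). For $\beta\in B_n$ one can write uniquely $P_{\widehat\beta}(v,z)=v^{w-n+1}\sum_{j=0}^{n-1}h_j(z)v^{2j}$ with $h_j\in\mathbb Z[z,z^{-1}]$ (a consequence of the Morton-Franks-Williams inequality); the $h_j$ are the Laurent MFW polynomials of $\beta$. $m$ and $M$ are the minimal and maximal $j$ with $h_j\ne0$; the $h_j$ with $m\le j\le M$ are called proper. $\deg$ and $\min\deg$ denote the highest and lowest power occurring. The Laurent polynomials $P_k(v)$ are defined by $P_{\widehat\beta}(v,z)=\sum_{s\ge0}P_{2s+1-\mu(\widehat\beta)}(v)\,z^{2s+1-\mu(\widehat\beta)}$. Conventions: $\binom{b}{a}=0$ if $a<0$ or $a>b$, and $\binom00=1$; $\delta_{a,b}$ is the Kronecker delta. The mirror image of a braid word $\prod\sigma_{i_k}^{e_k}$ is $\prod\sigma_{i_k}^{-e_k}$. *)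

(* Defs.v *)
From HB Require Import structures.
From mathcomp Require Import all_boot all_order all_algebra all_fingroup.
From mathcomp Require Import finmap.

Set Implicit Arguments.
Unset Strict Implicit.
Unset Printing Implicit Defensive.

Import GRing.Theory Num.Theory.

Local Open Scope ring_scope.

(* Finitely supported coefficient functions, with the convolution product. *)
Definition laurent (R : comNzRingType) := {fsfun int -> R with 0}.

Definition lcoef (R : comNzRingType) (p : laurent R) (i : int) : R := p i.

Section LaurentRing.
Local Open Scope fset_scope.
Local Open Scope ring_scope.
Variable R : comNzRingType.
Implicit Types f g h : laurent R.

HB.instance Definition _ := Choice.on (laurent R).

Definition ladd f g : laurent R :=
  [fsfun i in finsupp f `|` finsupp g => lcoef f i + lcoef g i].
Definition lopp f : laurent R := [fsfun i in finsupp f => - lcoef f i].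
Definition lzero : laurent R := [fsfun].
Definition lscale (c : R) f : laurent R := [fsfun i in finsupp f => c * lcoef f i].
Definition lmul f g : laurent R :=
  [fsfun k in [fset i + j | i in finsupp f, j in finsupp g]
     => \sum_(i <- finsupp f) lcoef f i * lcoef g (k - i)].

Definition lmonom (k : int) : laurent R := [fsfun i in [fset k] => 1].

Lemma laddE f g i : lcoef (ladd f g) i = lcoef f i + lcoef g i.
Proof.
rewrite {1}/lcoef /ladd fsfunE inE; case: ifP => // /negbT.
by rewrite negb_or => /andP[fi gi]; rewrite /lcoef !fsfun_dflt // addr0.
Qed.

Lemma loppE f i : lcoef (lopp f) i = - lcoef f i.
Proof.
by rewrite /lcoef /lopp fsfunE /lcoef; case: finsuppP => //; rewrite oppr0.
Qed.

Lemma lscaleE c f i : lcoef (lscale c f) i = c * lcoef f i.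
Proof.
by rewrite /lcoef /lscale fsfunE /lcoef; case: finsuppP => //; rewrite mulr0.
Qed.

Lemma lzeroE i : lcoef lzero i = 0.
Proof. by rewrite /lcoef fsfunE. Qed.

Lemma lmonomE k i : lcoef (lmonom k) i = (i == k)%:R.
Proof. by rewrite /lcoef /lmonom fsfunE inE; case: eqP. Qed.

Lemma lmul_wide (A : {fset int}) f g k : finsupp f `<=` A ->
  \sum_(i <- finsupp f) lcoef f i * lcoef g (k - i) = \sum_(i <- A) lcoef f i * lcoef g (k - i).
Proof.
move=> sfA; rewrite (big_fset_incl _ sfA) // => i _ fi.
by rewrite /lcoef fsfun_dflt // mul0r.
Qed.

Lemma lmulE f g k :
  lcoef (lmul f g) k = \sum_(i <- finsupp f) lcoef f i * lcoef g (k - i).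
Proof.
rewrite {1}/lcoef /lmul fsfunE; case: ifP => // /negbT kN.
rewrite big_seq big1 // => i fi.
case: (finsuppP g (k - i)) => [gN|gi]; first by rewrite /lcoef (fsfun_dflt gN) mulr0.
case/negP: kN; apply/imfset2P; exists i => //; exists (k - i) => //.
by rewrite addrC subrK.
Qed.

Lemma laurentP f g : (forall i, lcoef f i = lcoef g i) <-> f = g.
Proof. by split=> [fg|-> //]; apply/fsfunP. Qed.

Lemma laddA : associative ladd.
Proof. by move=> f g h; apply/laurentP=> i; rewrite !laddE addrA. Qed.
Lemma laddC : commutative ladd.
Proof. by move=> f g; apply/laurentP=> i; rewrite !laddE addrC. Qed.
Lemma ladd0 : left_id lzero ladd.
Proof. by move=> f; apply/laurentP=> i; rewrite laddE lzeroE add0r. Qed.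
Lemma laddN : left_inverse lzero lopp ladd.
Proof. by move=> f; apply/laurentP=> i; rewrite laddE loppE lzeroE addNr. Qed.

HB.instance Definition _ :=
  GRing.isZmodule.Build (laurent R) laddA laddC ladd0 laddN.

Lemma lmul_dbl f g k : lcoef (lmul f g) k =
  \sum_(i <- finsupp f) \sum_(j <- finsupp g)
     (if i + j == k then lcoef f i * lcoef g j else 0).
Proof.
rewrite lmulE; apply: eq_bigr => i _; rewrite -big_mkcond /=.
rewrite (eq_bigl (fun j => j == k - i)); last first.
  by move=> j; rewrite [RHS]eq_sym subr_eq addrC eq_sym.
case: (finsuppP g (k - i)) => [gN|gi].
  rewrite /lcoef (fsfun_dflt gN) mulr0 big_seq_cond big1 // => j /andP[gj /eqP ej].
  by case/negP: gN; rewrite -ej.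
by rewrite -big_filter (filter_pred1_uniq (fset_uniq _) gi) big_seq1.
Qed.

Lemma lmulC : commutative lmul.
Proof.
move=> f g; apply/laurentP=> k; rewrite !lmul_dbl exchange_big /=.
by apply: eq_bigr => j _; apply: eq_bigr => i _; rewrite addrC mulrC.
Qed.

Lemma lmulA : associative lmul.
Proof.
move=> f g h; apply/laurentP=> k.
rewrite (lmulC (lmul f g)) (lmulC g) !lmulE.
under eq_bigr do rewrite lmulE mulr_sumr.
under [RHS]eq_bigr do rewrite lmulE mulr_sumr.
rewrite exchange_big /=; apply: eq_bigr => j _; apply: eq_bigr => i _.
by rewrite mulrCA -!addrA (addrC (- i)).
Qed.

Lemma lmul1 : left_id (lmonom 0) lmul.
Proof.
move=> f; apply/laurentP=> k; rewrite lmulE.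
rewrite [LHS](lmul_wide (A := [fset 0])).
  by rewrite big_seq_fset1 -!/(lcoef _ _) lmonomE eqxx mul1r subr0.
apply/fsubsetP=> i; rewrite mem_finsupp -/(lcoef _ _) lmonomE inE.
by case: (i =P 0) => // _; rewrite mulr0n eqxx.
Qed.

Lemma lmulDl : left_distributive lmul ladd.
Proof.
move=> f g h; rewrite !(lmulC _ h); apply/laurentP=> k.
rewrite laddE !lmulE -big_split /=; apply: eq_bigr => i _.
by rewrite laddE mulrDr.
Qed.

Lemma lone_neq0 : lmonom 0 != lzero.
Proof.
apply/eqP=> /laurentP/(_ 0); rewrite lmonomE lzeroE eqxx => /eqP.
by rewrite oner_eq0.
Qed.

HB.instance Definition _ := GRing.Zmodule_isComNzRing.Build (laurent R)
  lmulA lmulC lmul1 lmulDl lone_neq0.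

Lemma lscaleA c d f : lscale c (lscale d f) = lscale (c * d) f.
Proof. by apply/laurentP=> i; rewrite !lscaleE mulrA. Qed.
Lemma lscale1 : left_id 1 lscale.
Proof. by move=> f; apply/laurentP=> i; rewrite !lscaleE mul1r. Qed.
Lemma lscaleDr : right_distributive lscale +%R.
Proof. by move=> c f g; apply/laurentP=> i; rewrite !(lscaleE, laddE) mulrDr. Qed.
Lemma lscaleDl f : {morph lscale^~ f : c d / c + d}.
Proof. by move=> c d; apply/laurentP=> i; rewrite !(lscaleE, laddE) mulrDl. Qed.

HB.instance Definition _ := GRing.Zmodule_isLmodule.Build R (laurent R)
  lscaleA lscale1 lscaleDr lscaleDl.

End LaurentRing.


Notation "p @_ k" := (lcoef p k)
  (at level 3, k at level 2, left associativity, format "p @_ k") : ring_scope.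

Arguments lmonom {R} k.

(* [laurent1] is Z[t, 1/t], where t is z or v according to the context;
   [laurent2] is Z[z, 1/z][v, 1/v], with v the outer variable: [P@_i@_k] is the
   coefficient of v^i z^k in P. *)
Notation laurent1 := (laurent int).
Notation laurent2 := (laurent (laurent int)).

Definition zpow (k : int) : laurent1 := lmonom k.
Definition vpow (k : int) : laurent2 := lmonom k.

(* The coefficient P_k(v) of z^k in P, a polynomial in v alone, and the powers
   of v as such polynomials. *)
Definition zpart (k : int) (P : laurent2) : laurent1 :=
  [fsfun i in finsupp P => P@_i@_k].

Definition vpow1 (k : int) : laurent1 := lmonom k.

Lemma zpartE k P i : (zpart k P)@_i = P@_i@_k.
Proof.
rewrite /zpart {1}/lcoef fsfunE; case: finsuppP => // iN.
by rewrite [P@_i]/lcoef fsfun_dflt // lzeroE.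
Qed.

Definition is_greatest (S : int -> Prop) (d : int) : Prop :=
  S d /\ forall k, S k -> k <= d.
Definition is_least (S : int -> Prop) (d : int) : Prop :=
  S d /\ forall k, S k -> d <= k.

Definition is_deg_v (P : laurent2) := is_greatest (fun i => P@_i != 0).
Definition is_mindeg_v (P : laurent2) := is_least (fun i => P@_i != 0).
Definition is_deg_z (P : laurent2) :=
  is_greatest (fun k => exists i, P@_i@_k != 0).

(* Words representing the elements of B_{k+1}, which has k generators: the
   letter (i, true) is sigma_{i+1} and (i, false) is its inverse. *)
Definition braid_word (k : nat) := seq ('I_k * bool).

Definition writhe k (b : braid_word k) : int :=
  \sum_(s <- b) (if s.2 then 1 else -1).

Definition mirror k (b : braid_word k) : braid_word k :=
  [seq (s.1, ~~ s.2) | s <- b].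

(* The inclusion of B_{k+1} into B_{k+2}. *)
Definition add_strand k (b : braid_word k) : braid_word k.+1 :=
  [seq (widen_ord (leqnSn k) s.1, s.2) | s <- b].

Definition gen_perm k (i : 'I_k) : 'S_k.+1 :=
  tperm (widen_ord (leqnSn k) i) (lift ord0 i).

Definition braid_perm k (b : braid_word k) : 'S_k.+1 :=
  (\prod_(s <- b) gen_perm s.1)%g.

(* The components of the closure correspond to the cycles of the permutation. *)
Definition ncomponents k (b : braid_word k) : nat :=
  #|porbits (braid_perm b)|.

(* Oriented links are presented as closed braids (Alexander), and two closed
   braids are isotopic iff the braids are related by the relations of the braid
   groups, conjugation and stabilisation (Markov). *)
Inductive isotopic_closures :
    forall k l, braid_word k -> braid_word l -> Prop :=
| iso_refl k (a : braid_word k) : isotopic_closures a a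
| iso_sym k l (a : braid_word k) (b : braid_word l) :
    isotopic_closures a b -> isotopic_closures b a
| iso_trans k l m (a : braid_word k) (b : braid_word l) (c : braid_word m) :
    isotopic_closures a b -> isotopic_closures b c -> isotopic_closures a c
| iso_cancel k (a b : braid_word k) (i : 'I_k) (e : bool) :
    isotopic_closures (a ++ [:: (i, e); (i, ~~ e)] ++ b) (a ++ b)
| iso_commute k (a b : braid_word k) (i j : 'I_k) : (i.+1 < j)%N ->
    isotopic_closures (a ++ [:: (i, true); (j, true)] ++ b)
                      (a ++ [:: (j, true); (i, true)] ++ b)
| iso_braid k (a b : braid_word k) (i j : 'I_k) : j = i.+1 :> nat ->
    isotopic_closures (a ++ [:: (i, true); (j, true); (i, true)] ++ b)
                      (a ++ [:: (j, true); (i, true); (j, true)] ++ b)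
| iso_conjugate k (a b : braid_word k) :
    isotopic_closures (a ++ b) (b ++ a)
| iso_stabilise k (a : braid_word k) (e : bool) :
    isotopic_closures a (rcons (add_strand a) (ord_max, e)).

(* [P _ b] is the Homflypt polynomial of the closure of b.  Any three oriented
   links with diagrams differing at one crossing are the closures of
   a sigma_i b, a b and a sigma_i^-1 b for some braids a and b.  The braid with
   one strand closes to the unknot. *)
Record is_homflypt (P : forall k, braid_word k -> laurent2) : Prop := {
  homflypt_isotopy : forall k l (a : braid_word k) (b : braid_word l),
    isotopic_closures a b -> P k a = P l b;
  homflypt_unknot : P 0%N [::] = 1;
  homflypt_skein : forall k (a b : braid_word k) (i : 'I_k),
    P k (a ++ (i, true) :: b) =
      vpow 1 * (zpow 1 *: P k (a ++ b))
      + vpow 2 * P k (a ++ (i, false) :: b)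
}.

(* For b in B_n with n = k + 1:
   P = v^(w - n + 1) (h_0 + h_1 v^2 + ... + h_(n-1) v^(2(n-1))). *)
Definition is_mfw_family k (b : braid_word k) (P : laurent2)
    (h : nat -> laurent1) : Prop :=
  P = vpow (writhe b - k.+1%:Z + 1)
      * \sum_(0 <= j < k.+1) h j *: vpow (2 * j%:Z).

Definition is_mfw_min (k : nat) (h : nat -> laurent1) (m : nat) : Prop :=
  [/\ (m < k.+1)%N, h m != 0
    & forall j, (j < k.+1)%N -> h j != 0 -> (m <= j)%N].
Definition is_mfw_max (k : nat) (h : nat -> laurent1) (M : nat) : Prop :=
  [/\ (M < k.+1)%N, h M != 0
    & forall j, (j < k.+1)%N -> h j != 0 -> (j <= M)%N].

(* The braids with b_min = 1 + M - m = 3 and deg_z P > 1 - mu, with their MFW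
   polynomials h and the degrees zeta, x and y of P. *)
Record bmin3 (P : forall k, braid_word k -> laurent2) k (b : braid_word k)
    (h : nat -> laurent1) (m M : nat) (zeta x y : int) : Prop := {
  bmin3_mfw : is_mfw_family b (P k b) h;
  bmin3_min : is_mfw_min k h m;
  bmin3_max : is_mfw_max k h M;
  bmin3_bmin : (1 + M - m = 3)%N;
  bmin3_zeta : is_deg_z (P k b) zeta;
  bmin3_x : is_mindeg_v (P k b) x;
  bmin3_y : is_deg_v (P k b) y;
  bmin3_gt : zeta > 1 - (ncomponents b)%:Z
}.

Definition binz (b a : int) : int :=
  if (0 <= a) && (a <= b) then 'C(`|b|, `|a|)%:Z else 0.

Definition kronecker (a b : int) : int := (a == b)%:Z.

(* Floor division; it is exact on zeta + x, zeta - x, zeta + y and zeta - y. *)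
Definition halfz (k : int) : int := (k %/ 2)%Z.

Definition case_I (zeta x : int) : Prop := -2 <= x <= zeta.
Definition case_II (zeta y : int) : Prop := -2 <= - y <= zeta.

Definition relations_I (zeta x : int) (a b c : int -> int) : Prop :=
  forall j : int,
  [/\ a (zeta - 2 * j) =
        binz (halfz (zeta + x) + 1 - j) (j - halfz (zeta - x))
        + c (zeta - 2 * j),
      x >= 0 -> b (zeta - 2 * j) =
        - binz (halfz (zeta + x) - j) (j - 1 - halfz (zeta - x))
        - 2 * c (zeta - 2 * j) - c (zeta - 2 - 2 * j)
    & x = -1 \/ x = -2 -> b (zeta - 2 * j) =
        (-1) ^ x * kronecker j (halfz (1 + zeta))
        - 2 * c (zeta - 2 * j) - c (zeta - 2 - 2 * j)].

Definition relations_II (zeta y : int) (a b c : int -> int) : Prop :=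
  forall j : int,
  [/\ y <= 0 -> b (zeta - 2 * j) =
        - ((-1) ^ y * binz (halfz (zeta - y) - j) (j - 1 - halfz (zeta + y)))
        - 2 * a (zeta - 2 * j) - a (zeta - 2 - 2 * j),
      y = 1 \/ y = 2 -> b (zeta - 2 * j) =
        kronecker j (halfz (1 + zeta))
        - 2 * a (zeta - 2 * j) - a (zeta - 2 - 2 * j)
    & c (zeta - 2 * j) =
        (-1) ^ y * binz (halfz (zeta - y) + 1 - j) (j - halfz (zeta + y))
        + a (zeta - 2 * j)].

(* Among the families of coefficients a_k, b_k, c_k (k = zeta mod 2) that
   vanish outside [lo, zeta] and satisfy the relations, any one of the three
   determines the other two. *)
Definition each_determines_others (lo zeta : int)
    (rel : (int -> int) -> (int -> int) -> (int -> int) -> Prop) : Prop :=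
  let vanishing (f : int -> int) := forall k, ~~ (lo <= k <= zeta) -> f k = 0 in
  let same (f g : int -> int) :=
    forall j : int, f (zeta - 2 * j) = g (zeta - 2 * j) in
  forall a b c a' b' c' : int -> int,
  vanishing a -> vanishing b -> vanishing c ->
  vanishing a' -> vanishing b' -> vanishing c' ->
  rel a b c -> rel a' b' c' ->
  same a a' \/ same b b' \/ same c c' ->
  [/\ same a a', same b b' & same c c'].

(* h = f_zeta z^zeta + f_(zeta-2) z^(zeta-2) + ... + f_lo z^lo, where
   lo = zeta - 2 N and f_k is the coefficient of z^k in h. *)
Definition expands_down (zeta : int) (N : nat) (h : laurent1) : Prop :=
  h = \sum_(0 <= s < N.+1) h@_(zeta - 2 * s%:Z) *: zpow (zeta - 2 * s%:Z).

(* Main.v *)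
Require Import Defs.
From mathcomp Require Import all_boot all_order all_algebra all_fingroup.
From mathcomp Require Import finmap.
From mathcomp Require Import zify ring.

Set Implicit Arguments.
Unset Strict Implicit.
Unset Printing Implicit Defensive.

Import GRing.Theory Num.Theory.

Local Open Scope ring_scope.

(** Write P = v^x (a + b v^2 + c v^4), where a, b, c are the three proper
    polynomials.  Everything follows from two facts about the Homflypt
    polynomial of a link.

    First, P = 1 whenever z = 1/v - v.  Indeed modulo 1/v - v - z the skein
    relation is satisfied by the constant 1.  In the quotient ring, which is
    free of rank 2 over Z[z, 1/z], the inverse of v satisfies u^2 = 1 + z u, so
    its powers are governed by the Fibonacci polynomials F_s, with
    F_(s+1) = z F_s + F_(s-1) for every integer s.  Pairing v^i with F_(s-i)
    vanishes on the ideal of 1/v - v - z, and P = 1 becomes the family of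
    linear identities sum_i P_i F_(s-i) = F_s ([homflypt_fib]).  For
    s = x + 2, x and x + 4 these read
      z (a - c) = F_(x+2),  z (b + (2 + z^2) c) = - F_x,
      z (b + (2 + z^2) a) = F_(x+4).
    They determine any two of a, b, c from the third one.  The coefficients of
    F_s are binomial coefficients for s >= 0, and F_(-s) = - (-1)^s F_s; the
    first and second identities are the relations of Case I, the first and
    third those of Case II.  One of the two cases holds because the
    leading coefficient of F_(x+2) is +-1 for x <> -2: a or c has degree at
    least x when x >= -1, and at least - x - 4 = - y when x <= -3.

    Secondly, the coefficient of the lowest power z^(1 - mu) is
    (1 - v^2)^(mu - 1) g with g(1) = 1, the exponents of z and v are congruent
    to 1 - mu modulo 2, and no lower power of z occurs
    ([homflypt_lowest_term]).  As that coefficient spans at most v^x, v^(x+2)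
    and v^(x+4), this gives mu <= 3, and P_(-2) when mu = 3.

    Both facts, and the formula for mirror images, are proved by induction on
    closed braids ([skein_induction]): as in the construction of the Ocneanu
    trace on Hecke algebras, the skein relation reduces every braid word to
    words in which the last generator occurs at most once, and these are
    handled by destabilisation or by splitting off an unknot. *)

(** * Induction on braids by the skein relation *)

Lemma commute_past (T : seq nat -> Prop) (t : nat) :
    (forall a b i j, (i.+1 < j)%N ->
       T (a ++ i :: j :: b) <-> T (a ++ j :: i :: b)) ->
  forall u p r, all (fun i => i.+1 < t)%N u ->
    T (p ++ t :: u ++ r) <-> T (p ++ u ++ t :: r).
Proof.
move=> far; elim=> [|i u IHu] p r //= /andP[it ut].
by rewrite -far //; have:= IHu (rcons p i) r ut; rewrite !cat_rcons.
Qed.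

Lemma split_first_letter (n : nat) (s : seq nat) :
  (0 < count_mem n s)%N ->
  exists p r, [/\ s = p ++ n :: r, count_mem n p = 0%N
                & count_mem n r = (count_mem n s).-1].
Proof.
elim: s => [|i s IHs] //=; case: eqP => [->|ni] /=.
  by move=> _; exists [::], s.
rewrite add0n => /IHs[p [r [-> p0 r1]]]; exists (i :: p), r; split=> //=.
by rewrite p0; case: eqP ni.
Qed.

Lemma count_mem_head (n : nat) (s : seq nat) :
  count_mem n (n :: s) = (count_mem n s).+1.
Proof. by rewrite /= eqxx. Qed.

(** Two occurrences of the last generator, with a word u in the others between
    them, can always be merged.  By induction on the number of strands u may be
    assumed to contain the previous generator at most once; the rest of u
    commutes with the last generator, so that the two occurrences either meet
    in a square or form a braid relation.  Only the square is reduced by the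
    skein relation, and each step lowers the number of occurrences. *)
Lemma hecke_reduction (n : nat) (T : seq nat -> Prop) :
    (forall a b i, T (a ++ b) -> T (a ++ i :: b) -> T (a ++ i :: i :: b)) ->
    (forall a b i j, (i.+1 < j)%N ->
       T (a ++ i :: j :: b) <-> T (a ++ j :: i :: b)) ->
    (forall a b i, (i.+1 < n)%N ->
       T (a ++ i :: i.+1 :: i :: b) <-> T (a ++ i.+1 :: i :: i.+1 :: b)) ->
    (forall s, all (fun i => i < n)%N s -> (count_mem n.-1 s <= 1)%N -> T s) ->
  forall s, all (fun i => i < n)%N s -> T s.
Proof.
elim: n T => [|n IHn] T sq far br base s sn.
  by apply: base => //; case: s sn.
have [N] := ubnP (count_mem n s); elim: N s sn => // N IHN s sn.
case: (leqP (count_mem n s) 1) => [s1 _|s2]; first exact: base.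
have [p [r' [es p0 cr']]] := split_first_letter (ltnW s2).
have /split_first_letter[u [r [er u0 cr]]]: (0 < count_mem n r')%N by lia.
rewrite ltnS => sN; move: sn; rewrite es er all_cat /= all_cat /=.
case/and5P=> pn _ un _ rn.
have {}un: all (fun i => i < n)%N u.
  apply/allP=> i iu; have:= allP un _ iu.
  rewrite ltnS leq_eqVlt => /orP[/eqP ein|//].
  by move: u0; rewrite -ein; move/count_memPn/negP; rewrite iu.
have nearer v : all (fun i => i < n)%N v -> (count_mem n.-1 v = 0)%N ->
    all (fun i => i.+1 < n)%N v.
  move=> vn v0; apply/allP=> i iv; have := allP vn _ iv.
  suff: i <> n.-1 by lia.
  by move=> ei; move: v0; rewrite -ei; move/count_memPn/negP; rewrite iv.
have cnt0 v : all (fun i => i < n)%N v -> count_mem n v = 0%N.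
  move=> vn; apply/count_memPn/negP=> /(allP vn); by rewrite ltnn.
have weak v : all (fun i => i < n)%N v -> all (fun i => i < n.+1)%N v.
  by apply: sub_all => i /= /ltnW.
have ind v : all (fun i => i < n)%N v ->
  T (p ++ v ++ r) /\ T (p ++ v ++ n :: r).
  move=> vn; split; apply: IHN.
  - by rewrite !all_cat pn rn weak.
  - rewrite !count_cat p0 cnt0 //; lia.
  - by rewrite !all_cat /= pn rn ltnSn weak.
  - rewrite !count_cat p0 cnt0 // count_mem_head; lia.
have rN : ((count_mem n r).+2 <= N)%N by lia.
pose T' v := T (p ++ n :: v ++ n :: r).
apply: (IHn T') un => {u u0 er cr cr' es}.
- move=> a b i; rewrite /T' -!catA -!cat_cons !(catA p) /=; exact: sq.
- move=> a b i j ij; rewrite /T' -!catA -!cat_cons !(catA p) /=; exact: far.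
- move=> a b i ij; rewrite /T' -!catA -!cat_cons !(catA p) /=; apply: br; lia.
move=> v vn v1; rewrite /T'.
(* n commutes with the whole of v, which leaves the square n n *)
have [v0|v0] := posnP (count_mem n.-1 v).
  have vc := nearer _ vn v0.
  apply/(commute_past far) => //.
  by rewrite catA; apply: sq; rewrite -catA; case: (ind _ vn).
(* v = v1 (n-1) v2, and n (n-1) n = (n-1) n (n-1) drops one n *)
have [v1' [v2 [ev c1 c2]]] := split_first_letter v0.
move: (vn); rewrite ev all_cat /= => /and3P[n1 nn n2].
have c1' := nearer _ n1 c1; have c2' : all (fun i => i.+1 < n)%N v2.
  by apply: nearer => //; lia.
rewrite -catA; apply/(commute_past far) => //.
rewrite catA /= -[_ :: _ :: _]/([:: n; n.-1] ++ _) catA.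
apply/(commute_past far) => //.
rewrite -!catA /= catA.
have en : n = n.-1.+1 by lia.
have bv := br (p ++ v1') (v2 ++ r) n.-1; rewrite -en in bv.
apply/(bv (ltnSn _)); rewrite -catA; apply: IHN.
  by rewrite !all_cat /= all_cat pn rn !weak // ltnSn (leq_trans nn (leqnSn n)).
rewrite -[_ :: _ :: _]/([:: n.-1] ++ n :: [:: n.-1] ++ v2 ++ r).
have cn: count_mem n [:: n.-1] = 0%N by rewrite cnt0 //= nn.
rewrite !count_cat count_mem_head !count_cat p0 cn (cnt0 _ n1) (cnt0 _ n2); lia.
Qed.

(** Words with positive letters come first because the braid relations relate
    such words; negative letters are then removed one by one.  A word where the
    last generator is absent gives a split unknot, and one where it occurs once
    is a stabilisation. *)
Lemma skein_induction (Q : forall k, braid_word k -> Prop) :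
    (forall k l (a : braid_word k) (b : braid_word l),
       isotopic_closures a b -> Q k a -> Q l b) ->
    Q 0%N [::] ->
    (forall k (a : braid_word k), Q k a -> Q k.+1 (add_strand a)) ->
    (forall k (a b : braid_word k) (i : 'I_k) (e : bool),
       Q k (a ++ b) -> Q k (a ++ (i, ~~ e) :: b) -> Q k (a ++ (i, e) :: b)) ->
  forall k (w : braid_word k), Q k w.
Proof.
move=> Qiso Q0 Qadd Qskein.
pose posw k (s : seq nat) : braid_word k :=
  [seq (i, true) | i <- pmap insub s].
have poswE k s t : posw k (s ++ t) = posw k s ++ posw k t.
  by rewrite /posw pmap_cat map_cat.
have posw1 k i (ik : (i < k)%N) s :
    posw k (i :: s) = (Ordinal ik, true) :: posw k s.
  by rewrite /posw /= insubT.
have posw0 k i s : (k <= i)%N -> posw k (i :: s) = posw k s.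
  by move=> ki; rewrite /posw /= insubF // ltnNge ki.
have positive k s : all (fun i => i < k)%N s -> Q k (posw k s).
  elim: k s => [|k IHk] s; first by case: s.
  move: s; apply: (hecke_reduction (T := fun s => Q _ (posw _ s))).
  - move=> a b i Qab Qaib; have [ki|ik] := leqP k.+1 i.
      by rewrite poswE !posw0 // -poswE.
    move: Qab Qaib; rewrite !poswE !(posw1 _ _ ik).
    set j := Ordinal ik => Qab Qajb.
    rewrite -cat_rcons; apply: Qskein; rewrite cat_rcons //.
    by apply: (Qiso _ _ _ _ _ Qab); apply: iso_sym; apply: iso_cancel.
  - move=> a b i j ij; have [kj|jk] := leqP k.+1 j.
      rewrite !poswE (posw0 _ j) //; have [ki|ik] := leqP k.+1 i.
        by rewrite !posw0.
      by rewrite !(posw1 _ _ ik) posw0.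
    have ik : (i < k.+1)%N by lia.
    rewrite !poswE !(posw1 _ _ ik, posw1 _ _ jk).
    have c := @iso_commute _ (posw _ a) (posw _ b) (Ordinal ik) (Ordinal jk) ij.
    by split; apply: Qiso => //; apply: iso_sym.
  - move=> a b i jk; have ik : (i < k.+1)%N by lia.
    rewrite !poswE !(posw1 _ _ ik, posw1 _ _ jk).
    have c := @iso_braid _ (posw _ a) (posw _ b)
      (Ordinal ik) (Ordinal jk) erefl.
    by split; apply: Qiso => //; apply: iso_sym.
  have addw s : all (fun i => i < k)%N s -> posw k.+1 s = add_strand (posw k s).
    elim: s => // i s IHs sk; have /andP[ik /IHs] := sk.
    have ik' : (i < k.+1)%N by lia.
    rewrite (posw1 _ _ ik') (posw1 _ _ ik) => -> /=.
    by congr ((_, _) :: _); apply: val_inj.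
  move=> s sk /=.
  have lower t : all (fun i => i < k.+1)%N t -> count_mem k t = 0%N ->
      all (fun i => i < k)%N t.
    move=> tk t0; apply/allP=> i it; have := allP tk _ it.
    rewrite ltnS leq_eqVlt => /orP[/eqP ei|//].
    by move: t0; rewrite -ei; move/count_memPn/negP; rewrite it.
  have [s0|s0] := posnP (count_mem k s) => s1.
    have {}sk := lower _ sk s0.
    by rewrite addw //; apply: Qadd; apply: IHk.
  have [p [r [es p0 cr]]] := split_first_letter s0.
  move: sk; rewrite es all_cat /= => /and3P[pk _ rk].
  have r0: count_mem k r = 0%N.
    by have := (s1 : (count_mem k s <= 1)%N); lia.
  have rpk: all (fun i => i < k)%N (r ++ p) by rewrite all_cat !lower.
  have stab := iso_stabilise (posw k (r ++ p)) true.
  rewrite poswE (posw1 _ _ (ltnSn k)) -cat_rcons.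
  apply: (Qiso _ _ _ _ _ (IHk _ rpk)).
  apply: iso_trans stab _; rewrite -addw // poswE rcons_cat -rcons_cat.
  rewrite rcons_cat; have -> : Ordinal (ltnSn k) = ord_max by apply: val_inj.
  exact: iso_conjugate.
move=> k w.
suff Qw u : Q k ([seq (i, true) | i <- u] ++ w) by exact: (Qw [::]).
elim: w u => [|[i e] w IHw] u.
  have:= positive k (map val u).
  rewrite cats0 /posw; set v := pmap _ _.
  have ->: v = u by apply: map_pK; apply: valK.
  by apply; apply/allP=> _ /mapP[j _ ->] /=.
have Qtrue : Q k ([seq (i, true) | i <- u] ++ (i, true) :: w).
  by have:= IHw (rcons u i); rewrite map_rcons cat_rcons.
by case: e => //; apply: Qskein.
Qed.

(** * The number of components *)

Lemma porbit_inj_morph (T U : finType) (f : T -> U) (s : {perm T})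
    (t : {perm U}) :
  injective f -> {morph f : x / s x >-> t x} ->
  forall x, porbit t (f x) = [set f y | y in porbit s x].
Proof.
move=> finj fs x; have fX i y : f ((s ^+ i)%g y) = (t ^+ i)%g (f y).
  by elim: i y => [|i IHi] y; rewrite ?perm1 // !expgSr !permM fs IHi.
apply/setP=> u; apply/porbitP/imsetP => [[i ->]|[y /porbitP[i ->] ->]].
  by exists ((s ^+ i)%g x); rewrite ?fX // mem_porbit.
by exists i; rewrite fX.
Qed.

Lemma card_porbits_mulC (T : finType) (s t : {perm T}) :
  #|porbits (s * t)%g| = #|porbits (t * s)%g|.
Proof.
have st x : s ((s * t)%g x) = (t * s)%g (s x) by rewrite !permM.
have E := porbit_inj_morph (@perm_inj _ s) st.
have ->: porbits (t * s)%g =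
    [set [set s y | y in A] | A : {set T} in porbits (s * t)%g].
  apply/setP=> B; apply/imsetP/imsetP => [[x _ ->]|[_ /imsetP[x _ ->] ->]].
    exists (porbit (s * t)%g ((s^-1)%g x)); first by rewrite imset_f.
    by rewrite -E permKV.
  by exists (s x); rewrite ?E.
by rewrite card_imset //; apply/imset_inj/perm_inj.
Qed.

Lemma braid_perm_cat k (a b : braid_word k) :
  braid_perm (a ++ b) = (braid_perm a * braid_perm b)%g.
Proof. exact: big_cat. Qed.

Lemma braid_perm_cons k s (b : braid_word k) :
  braid_perm (s :: b) = (gen_perm s.1 * braid_perm b)%g.
Proof. exact: big_cons. Qed.

Lemma ncomponents_catC k (a b : braid_word k) :
  ncomponents (a ++ b) = ncomponents (b ++ a).
Proof. by rewrite /ncomponents !braid_perm_cat card_porbits_mulC. Qed.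

(** Multiplication by a transposition merges two cycles or splits one. *)
Lemma ncomponents_smooth k (a b : braid_word k) (i : 'I_k) (e : bool) :
  ncomponents (a ++ (i, e) :: b) = (ncomponents (a ++ b)).+1 \/
  ncomponents (a ++ b) = (ncomponents (a ++ (i, e) :: b)).+1.
Proof.
rewrite ncomponents_catC (ncomponents_catC a) cat_cons /ncomponents.
rewrite braid_perm_cons /=; set s := braid_perm _.
have := porbits_mul_tperm s (widen_ord (leqnSn k) i) (lift ord0 i).
rewrite /= -/(gen_perm i).
have -> : widen_ord (leqnSn k) i != lift ord0 i.
  by apply/eqP=> /(congr1 val) /=; rewrite /bump; lia.
by case: (_ \notin _) => /=; rewrite addn1 ?addn0 ?addn2; lia.
Qed.

Section AddStrand.
Variables (k : nat) (a : braid_word k).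
Let w (x : 'I_k.+1) : 'I_k.+2 := widen_ord (leqnSn k.+1) x.

Lemma widen_strand_inj : injective w.
Proof. by move=> x y /(congr1 val) xy; apply: val_inj. Qed.

Lemma braid_perm_add_strand_widen :
  {morph w : x / braid_perm a x >-> braid_perm (add_strand a) x}.
Proof.
elim: a => [|s b IHb] x; first by rewrite /braid_perm !big_nil !perm1.
rewrite /= !braid_perm_cons !permM IHb; congr (braid_perm _ _).
rewrite /gen_perm (inj_tperm _ _ _ widen_strand_inj).
by congr (tperm _ _ _); apply: val_inj.
Qed.

Lemma braid_perm_add_strand_max : braid_perm (add_strand a) ord_max = ord_max.
Proof.
elim: a => [|s b IHb]; first by rewrite /braid_perm big_nil perm1.
rewrite /= braid_perm_cons permM tpermD ?IHb //.
  by apply/eqP=> /(congr1 val) /=; have := ltn_ord s.1; lia.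
by apply/eqP=> /(congr1 val) /=; rewrite /bump; have := ltn_ord s.1; lia.
Qed.

Lemma porbit_add_strand_max :
  porbit (braid_perm (add_strand a)) ord_max = [set ord_max].
Proof.
apply/setP=> u; rewrite inE; apply/porbitP/eqP => [[i ->]|->].
  elim: i => [|i IHi]; first by rewrite perm1.
  by rewrite expgSr permM IHi braid_perm_add_strand_max.
by exists 0%N; rewrite perm1.
Qed.

Lemma ncomponents_add_strand : ncomponents (add_strand a) = (ncomponents a).+1.
Proof.
have E := porbit_inj_morph widen_strand_inj braid_perm_add_strand_widen.
set t := braid_perm (add_strand a) in E *.
pose wimage (A : {set 'I_k.+1}) := [set w y | y in A].
have max_w x : ord_max != w x.
  by apply/eqP=> /(congr1 val) /=; have := ltn_ord x; lia.
rewrite /ncomponents.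
have ->: porbits t =
    [set ord_max] |: [set wimage A | A in porbits (braid_perm a)].
  apply/setP=> B; rewrite in_setU1; apply/imsetP/orP.
    case=> u _ ->; have [->|ux] := eqVneq u ord_max.
      by left; rewrite porbit_add_strand_max.
    right; have uk : (u < k.+1)%N.
      rewrite ltn_neqAle -ltnS ltn_ord andbT; apply: contra ux => /eqP uk.
      by apply/eqP/val_inj.
    have -> : u = w (Ordinal uk) by apply: val_inj.
    by rewrite E; apply/imset_f/imset_f.
  case=> [/eqP->|/imsetP[_ /imsetP[x _ ->] ->]].
    by exists ord_max; rewrite ?porbit_add_strand_max.
  by exists (w x); rewrite ?E.
rewrite cardsU1 card_imset; last exact/imset_inj/widen_strand_inj.
rewrite -[in RHS]add1n; congr (_ + _)%N; rewrite (_ : _ \notin _) //.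
apply/imsetP=> -[A _ eA]; have: ord_max \in wimage A by rewrite -eA inE.
by case/imsetP=> x _ /eqP; rewrite (negPf (max_w x)).
Qed.

Lemma ncomponents_stabilise e :
  ncomponents (rcons (add_strand a) (ord_max, e)) = ncomponents a.
Proof.
rewrite -cats1 ncomponents_catC /= /ncomponents braid_perm_cons /=.
have := porbits_mul_tperm (braid_perm (add_strand a))
  (widen_ord (leqnSn k.+1) ord_max) (lift ord0 ord_max).
rewrite /= -/(gen_perm _).
have -> : lift ord0 ord_max = ord_max :> 'I_k.+2 by apply: val_inj.
rewrite porbit_add_strand_max.
rewrite inE (_ : widen_ord _ _ == _ = false); last first.
  by apply/eqP=> /(congr1 val) /=; lia.
have := ncomponents_add_strand; rewrite /ncomponents => ->; rewrite /=; lia.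
Qed.

End AddStrand.

Lemma ncomponents_isotopy k l (a : braid_word k) (b : braid_word l) :
  isotopic_closures a b -> ncomponents a = ncomponents b.
Proof.
elim=> {k l a b} //.
- by move=> k l m a b c _ -> _ ->.
- move=> k a b i e; rewrite /ncomponents !braid_perm_cat !braid_perm_cons.
  by rewrite /braid_perm big_nil mulg1 /= tperm2 mul1g.
- move=> k a b i j ij; rewrite /ncomponents !braid_perm_cat !braid_perm_cons.
  rewrite [braid_perm [::]]big_nil !mulg1 /=.
  have -> // : (gen_perm i * gen_perm j = gen_perm j * gen_perm i)%g.
  rewrite conjgC tpermJ !tpermD //;
    by apply/eqP=> /(congr1 val) /=; rewrite /bump; lia.
- move=> k a b i j ij; rewrite /ncomponents !braid_perm_cat !braid_perm_cons.
  rewrite [braid_perm [::]]big_nil !mulg1 /=.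
  have conj (s t : 'S_k.+1) : (s * s = 1 -> s * (t * s) = t ^ s)%g.
    move=> s2; rewrite conjgE; congr (_ * _)%g.
    by apply: (mulIg s); rewrite mulVg.
  rewrite !conj ?tperm2 // !tpermJ.
  rewrite /gen_perm.
  have -> : widen_ord (leqnSn k) j = lift ord0 i by apply: val_inj.
  rewrite tpermR tpermL !tpermD //;
    by apply/eqP=> /(congr1 val) /=; rewrite /bump; lia.
- by move=> k a b; exact: ncomponents_catC.
- by move=> k a e; rewrite ncomponents_stabilise.
Qed.

(** * Laurent polynomials *)

Section Laurent.
Variable R : comNzRingType.
Implicit Types (f g : laurent R) (phi : int -> R).

Lemma lcoefD f g i : (f + g)@_i = f@_i + g@_i.
Proof. exact: laddE. Qed.

Lemma lcoefN f i : (- f)@_i = - f@_i.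
Proof. exact: loppE. Qed.

Lemma lcoefB f g i : (f - g)@_i = f@_i - g@_i.
Proof. by rewrite lcoefD lcoefN. Qed.

Lemma lcoefZ c f i : (c *: f)@_i = c * f@_i.
Proof. exact: lscaleE. Qed.

Lemma lcoef0 i : (0 : laurent R)@_i = 0.
Proof. exact: lzeroE. Qed.

Lemma lcoef_sum (I : Type) (r : seq I) (F : I -> laurent R) i :
  (\sum_(j <- r) F j)@_i = \sum_(j <- r) (F j)@_i.
Proof. by elim/big_rec2: _ => [|j _ f _ <-]; rewrite ?lcoef0 ?lcoefD. Qed.

Lemma lmonom0 : lmonom 0 = 1 :> laurent R.
Proof. by []. Qed.

Lemma lcoef_monomM k f i : (lmonom k * f)@_i = f@_(i - k).
Proof.
rewrite [LHS]lmulE (lmul_wide (A := [fset k]%fset)).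
  by rewrite big_seq_fset1 lmonomE eqxx mul1r.
apply/fsubsetP=> j; rewrite mem_finsupp -/(lcoef _ _) lmonomE inE.
by case: (j =P k) => // _; rewrite mulr0n eqxx.
Qed.

Lemma lmonomD j k : lmonom (j + k) = lmonom j * lmonom k :> laurent R.
Proof.
by apply/laurentP=> i; rewrite lcoef_monomM !lmonomE subr_eq addrC.
Qed.

Lemma laurent_scalerAl c f g : c *: f * g = c *: (f * g).
Proof.
have cf : (finsupp (c *: f)%R `<=` finsupp f)%fset.
  apply/fsubsetP=> i; rewrite !mem_finsupp -!/(lcoef _ _) lcoefZ.
  by apply: contraNN => /eqP->; rewrite mulr0.
apply/laurentP=> k; rewrite lcoefZ [LHS]lmulE (lmul_wide _ _ cf) [in RHS]lmulE.
by rewrite mulr_sumr; apply: eq_bigr => i _; rewrite lcoefZ mulrA.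
Qed.

(** This is evaluation at u when [phi i] is u^i; the Fibonacci polynomials give
    functionals that are not evaluations. *)
Definition lpair phi f : R := \sum_(i <- finsupp f) f@_i * phi i.

Lemma lpair_wide (A : {fset int}) phi f :
  (finsupp f `<=` A)%fset -> lpair phi f = \sum_(i <- A) f@_i * phi i.
Proof.
move=> fA; rewrite /lpair (big_fset_incl _ fA) // => i _ fi.
by rewrite /lcoef fsfun_dflt // mul0r.
Qed.

Lemma lpairD phi f g : lpair phi (f + g) = lpair phi f + lpair phi g.
Proof.
pose A := (finsupp f `|` finsupp g `|` finsupp (f + g)%R)%fset.
have fA : (finsupp f `<=` A)%fset by rewrite /A -fsetUA fsubsetUl.
have gA : (finsupp g `<=` A)%fset by rewrite /A fsetUAC fsubsetUr.
have fgA : (finsupp (f + g)%R `<=` A)%fset by rewrite fsubsetUr.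
rewrite (lpair_wide _ fA) (lpair_wide _ gA) (lpair_wide _ fgA) -big_split /=.
by apply: eq_bigr => i _; rewrite lcoefD mulrDl.
Qed.

Lemma lpairZ phi c f : lpair phi (c *: f) = c * lpair phi f.
Proof.
pose A := (finsupp f `|` finsupp (c *: f)%R)%fset.
rewrite !(lpair_wide (A := A)) ?fsubsetUl ?fsubsetUr // mulr_sumr.
by apply: eq_bigr => i _; rewrite lcoefZ mulrA.
Qed.

Lemma lpairB phi f g : lpair phi (f - g) = lpair phi f - lpair phi g.
Proof. by rewrite lpairD -scaleN1r lpairZ mulN1r. Qed.

Lemma lpair_eq phi psi f : phi =1 psi -> lpair phi f = lpair psi f.
Proof. by move=> e; apply: eq_bigr => i _; rewrite e. Qed.

Lemma lpair_monomM phi k f :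
  lpair phi (lmonom k * f) = lpair (fun i => phi (i + k)) f.
Proof.
have sub: (finsupp (lmonom k * f)%R `<=`
    [fset (i + k)%R | i in finsupp f])%fset.
  apply/fsubsetP=> i; rewrite mem_finsupp -/(lcoef _ _) lcoef_monomM => fi.
  apply/imfsetP; exists (i - k); rewrite ?subrK //= mem_finsupp.
  exact: fi.
rewrite (lpair_wide _ sub) /lpair big_imfset /=; last by move=> i j _ _ /addIr.
by apply: eq_bigr => i _; rewrite lcoef_monomM addrK.
Qed.

Lemma lpair_monom phi k : lpair phi (lmonom k) = phi k.
Proof.
rewrite (lpair_wide (A := [fset k]%fset)); last first.
  apply/fsubsetP=> j; rewrite mem_finsupp -/(lcoef _ _) lmonomE inE.
  by case: (j =P k) => // _; rewrite mulr0n eqxx.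
by rewrite big_seq_fset1 lmonomE eqxx mul1r.
Qed.

End Laurent.

Lemma zpartD k p q : zpart k (p + q) = zpart k p + zpart k q.
Proof. by apply/laurentP=> i; rewrite lcoefD !zpartE lcoefD lcoefD. Qed.

Lemma zpartB k p q : zpart k (p - q) = zpart k p - zpart k q.
Proof. by apply/laurentP=> i; rewrite lcoefB !zpartE lcoefB lcoefB. Qed.

Lemma zpart_vpowM k j p : zpart k (vpow j * p) = vpow1 j * zpart k p.
Proof. by apply/laurentP=> i; rewrite lcoef_monomM !zpartE lcoef_monomM. Qed.

Lemma zpart_zpowZ k j (c : int) p :
  zpart k ((c *: zpow j) *: p) = c *: zpart (k - j) p.
Proof.
apply/laurentP=> i; rewrite lcoefZ !zpartE lcoefZ laurent_scalerAl lcoefZ.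
by rewrite lcoef_monomM.
Qed.

(** * Fibonacci polynomials *)

Fixpoint fibnat (n : nat) : laurent1 :=
  match n with
  | 0 => 0
  | n1.+1 => if n1 is n2.+1 then zpow 1 * fibnat n1 + fibnat n2 else 1
  end.

(** F_(-s) = - (-1)^s F_s extends the recurrence to negative indices. *)
Definition fib (s : int) : laurent1 :=
  match s with
  | Posz n => fibnat n
  | Negz n => (-1) ^+ n * fibnat n.+1
  end.

Lemma fibnatSS n : fibnat n.+2 = zpow 1 * fibnat n.+1 + fibnat n.
Proof. by []. Qed.

Lemma fibN n : fib (- n%:Z) = (-1) ^+ n.+1 * fibnat n.
Proof.
case: n => [|n]; first by rewrite /= mulr0.
by rewrite -NegzE /fib !exprS !mulN1r opprK.
Qed.

Lemma fib_rec s : fib (s + 1) = zpow 1 * fib s + fib (s - 1).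
Proof.
case: s => [[|n]|[|n]].
- by rewrite /= mulr0 add0r expr0 mul1r.
- have -> : (n.+1%:Z + 1 = n.+2 :> int) by lia.
  by have -> : (n.+1%:Z - 1 = n :> int) by lia.
- by rewrite /=; ring.
have -> : (Negz n.+1 + 1 = Negz n :> int) by lia.
have -> : (Negz n.+1 - 1 = Negz n.+2 :> int) by lia.
by rewrite /fib (fibnatSS n.+1) (fibnatSS n) !exprS; ring.
Qed.

Lemma lcoef_signM n (f : laurent1) k : ((-1) ^+ n * f)@_k = (-1) ^+ n * f@_k.
Proof.
elim: n => [|n IHn]; first by rewrite !expr0 !mul1r.
by rewrite !exprS -!mulrA !mulN1r lcoefN IHn.
Qed.

Lemma binz_small b a : a < 0 \/ b < a -> binz b a = 0.
Proof. by rewrite /binz; case: ifP => //; lia. Qed.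

Lemma binz_rec b a : 0 <= b -> binz (b + 1) a = binz b a + binz b (a - 1).
Proof.
case: b => // b _; rewrite -PoszD.
case: a => [[|a]|a]; last by rewrite !binz_small //; lia.
  by rewrite (@binz_small _ (0 - 1)) ?addr0 /binz //=; [rewrite !bin0|lia].
have -> : (a.+1%:Z - 1 = a) by lia.
rewrite /binz /= !lez_nat addn1 binS ltnS.
case: ifP => [ab|]; last by case: ltnP; lia.
case: ltnP => [_|ba]; first by rewrite PoszD.
by rewrite add0r bin_small.
Qed.

(** The recurrence is Pascal's rule, in which the exception b + 1 = a = 0 does
    not occur. *)
Lemma lcoef_fibnat (n : nat) (i : int) :
  (fibnat n)@_(n%:Z - 1 - 2 * i) = binz (n%:Z - 1 - i) i.
Proof.
have [N] := ubnP n; elim: N n i => // N IHN [|[|n]] i nN.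
- by rewrite lcoef0 binz_small //; lia.
- rewrite [fibnat 1]/= -lmonom0 lmonomE.
  have -> : (1%:Z - 1 - 2 * i == 0) = (i == 0) by lia.
  case: eqP => [->|i0] //; rewrite binz_small //; lia.
rewrite fibnatSS lcoefD lcoef_monomM.
have -> : n.+2%:Z - 1 - 2 * i - 1 = n.+1%:Z - 1 - 2 * i by lia.
have -> : n.+2%:Z - 1 - 2 * i = n%:Z - 1 - 2 * (i - 1) by lia.
rewrite !IHN; [|lia|lia].
have -> : n%:Z - 1 - (i - 1) = n%:Z - i by lia.
have -> : n.+1%:Z - 1 - i = n%:Z - i by lia.
have -> : n.+2%:Z - 1 - i = n%:Z - i + 1 by lia.
have [ni|ni] := lerP 0 (n%:Z - i); first by rewrite binz_rec.
by rewrite !binz_small //; lia.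
Qed.

(** * The values of the Homflypt polynomial at z = 1/v - v *)

Section Homflypt.
Variables (P : forall k, braid_word k -> laurent2) (hP : is_homflypt P).

Definition crossing_sign (e : bool) : int := if e then 1 else -1.

Lemma homflypt_skein_sign k (a b : braid_word k) (i : 'I_k) (e : bool) :
  P (a ++ (i, e) :: b) =
    vpow (crossing_sign e) * ((crossing_sign e *: zpow 1) *: P (a ++ b))
    + vpow (2 * crossing_sign e) * P (a ++ (i, ~~ e) :: b).
Proof.
have sk := homflypt_skein hP a b i.
case: e => /=; first by rewrite scale1r mulr1.
rewrite mulrN1 scaleN1r scaleNr mulrN sk mulrDr !mulrA /vpow -!lmonomD.
by rewrite addKr lmonom0 mul1r.
Qed.

(** The two stabilisations of a, with a positive and a negative crossing, have
    the same closure as a; smoothing that crossing adds a split unknot. *)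
Lemma homflypt_add_strand k (a : braid_word k) :
  vpow 1 * (zpow 1 *: P (add_strand a)) = P a - vpow 2 * P a.
Proof.
have sk := homflypt_skein hP (add_strand a) [::] ord_max.
move: sk; rewrite !cats1 !(homflypt_isotopy hP (iso_sym (iso_stabilise a _))).
by rewrite cats0 => {1}->; rewrite addrK.
Qed.

(** The equation P = 1 at z = 1/v - v, in terms of the functionals that send v^i
    to F_(s-i): these vanish on the multiples of 1/v - v - z. *)
Lemma homflypt_fib k (w : braid_word k) s :
  lpair (fun i => fib (s - i)) (P w) = fib s.
Proof.
elim/skein_induction: w s => {k} [k l a b ab Pa||k a Pa|k a b i e Pab Pe] s.
- by rewrite -(homflypt_isotopy hP ab).
- by rewrite homflypt_unknot // -lmonom0 lpair_monom subr0.
- have := congr1 (lpair (fun i => fib (s + 1 - i))) (homflypt_add_strand a).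
  rewrite lpairB !lpair_monomM lpairZ Pa.
  rewrite (@lpair_eq _ _ (fun i => fib (s - i)));
    last by move=> i; congr fib; ring.
  rewrite (@lpair_eq _ _ (fun i => fib (s - 1 - i)) (P a));
    last by move=> i; congr fib; ring.
  rewrite Pa fib_rec addrK => /(congr1 ( *%R (zpow (-1)))).
  by rewrite !mulrA /zpow -!lmonomD addNr lmonom0 !mul1r.
rewrite homflypt_skein_sign lpairD !lpair_monomM lpairZ.
rewrite (@lpair_eq _ _ (fun i => fib (s - crossing_sign e - i)));
  last by move=> j; congr fib; ring.
rewrite Pab.
rewrite (@lpair_eq _ _ (fun i => fib (s - 2 * crossing_sign e - i)));
  last by move=> j; congr fib; ring.
rewrite Pe; case: e {Pe}; rewrite /crossing_sign.
  rewrite scale1r; have := fib_rec (s - 1).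
  have -> : s - 1 + 1 = s by ring.
  by have -> : s - 1 - 1 = s - 2 * 1 by ring.
rewrite scaleN1r; have := fib_rec (s + 1); rewrite addrK.
have -> : s + 1 + 1 = s - 2 * -1 by ring.
by move=> ->; rewrite opprK mulNr addKr.
Qed.
End Homflypt.

(** * The lowest power of z *)

Lemma ncomponents_gt0 k (b : braid_word k) : (0 < ncomponents b)%N.
Proof.
by apply/card_gt0P; exists (porbit (braid_perm b) ord0); apply: imset_f.
Qed.

Lemma ncomponents_unknot : ncomponents ([::] : braid_word 0) = 1%N.
Proof.
apply/eqP; rewrite eqn_leq ncomponents_gt0 andbT /ncomponents.
by rewrite (leq_trans (leq_imset_card _ _)) // card_ord.
Qed.

Definition eval1 (f : laurent1) : int := lpair (fun=> 1) f.

Lemma eval1D f g : eval1 (f + g) = eval1 f + eval1 g.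
Proof. exact: lpairD. Qed.

Lemma eval1_vpow1M k f : eval1 (vpow1 k * f) = eval1 f.
Proof. by rewrite /eval1 lpair_monomM. Qed.

Lemma eval1_vanish f : eval1 ((1 - vpow1 2) * f) = 0.
Proof. by rewrite mulrBl mul1r /eval1 lpairB lpair_monomM subrr. Qed.

(** For a link with n components, g is, up to a power of v, the product of the
    coefficients of z^0 in the polynomials of the components. *)
Definition lowest_term (n : nat) (p : laurent2) : Prop :=
  (forall i k, p@_i@_k != 0 ->
     [/\ 1 - n%:Z <= k, (2 %| k - (1 - n%:Z))%Z & (2 %| i - (1 - n%:Z))%Z]) /\
  exists g, zpart (1 - n%:Z) p = (1 - vpow1 2) ^+ n.-1 * g /\ eval1 g = 1.

Lemma lcoef_scaled_shift i j c k (p : laurent2) t :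
  (vpow j * ((c *: zpow k) *: p))@_i@_t = c * p@_(i - j)@_(t - k).
Proof.
by rewrite lcoef_monomM lcoefZ laurent_scalerAl lcoefZ lcoef_monomM.
Qed.

Section Homflypt.
Variables (P : forall k, braid_word k -> laurent2) (hP : is_homflypt P).

(** A crossing between two components has a smoothing with n - 1 components,
    whose contribution z P_0 starts in degree 3 - n and does not reach z^(1-n).
    A crossing of a component with itself has a smoothing with n + 1
    components; its contribution to z^(1-n) has an additional factor 1 - v^2,
    which does not change g(1). *)
Lemma homflypt_lowest_term k (w : braid_word k) :
  lowest_term (ncomponents w) (P w).
Proof.
elim/skein_induction: w => {k}
  [k l a b ab Pa||k a [supp [g [ga g1]]]|k a b i e].
- by rewrite -(homflypt_isotopy hP ab) -(ncomponents_isotopy ab).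
- rewrite ncomponents_unknot homflypt_unknot //; split.
    move=> i k; rewrite -lmonom0 lmonomE.
    case: (i =P 0) => [->|_]; last by rewrite lcoef0 eqxx.
    by rewrite mulr1n -lmonom0 lmonomE; case: (k =P 0) => // ->.
  exists 1; split; last by rewrite -lmonom0 /eval1 lpair_monom.
  rewrite expr0 mul1r; apply/laurentP=> i; rewrite zpartE -!lmonom0 !lmonomE.
  by case: (i =P 0); rewrite ?lcoef0 //= mulr1n -lmonom0 lmonomE.
- rewrite ncomponents_add_strand; have n0 := ncomponents_gt0 a.
  have E := homflypt_add_strand hP a.
  rewrite -(scale1r (zpow 1)) in E; split.
    move=> i t; have := congr1 (fun p : laurent2 => p@_(i + 1)@_(t + 1)) E.
    rewrite lcoef_scaled_shift mul1r !addrK !lcoefB lcoef_monomM => -> P0.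
    have: (P a)@_(i + 1)@_(t + 1) != 0 \/ (P a)@_(i + 1 - 2)@_(t + 1) != 0.
      apply/orP; apply: contraNT P0; rewrite negb_or !negbK.
      by case/andP=> /eqP-> /eqP->.
    by case=> /supp[*]; split; lia.
  exists (vpow1 (-1) * g); split; last by rewrite eval1_vpow1M.
  have := congr1 (zpart (1 - (ncomponents a)%:Z)) E.
  rewrite zpart_vpowM zpart_zpowZ scale1r zpartB zpart_vpowM ga.
  have -> : 1 - (ncomponents a)%:Z - 1 = 1 - (ncomponents a).+1%:Z by lia.
  move=> /(congr1 ( *%R (vpow1 (-1)))).
  rewrite mulrA {1 2}/vpow1 -lmonomD addNr lmonom0 mul1r => ->.
  have -> : (1 - vpow1 2) ^+ (ncomponents a).+1.-1
      = (1 - vpow1 2) * (1 - vpow1 2) ^+ (ncomponents a).-1.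
    by rewrite -exprS prednK.
  move: ((1 - vpow1 2) ^+ (ncomponents a).-1) => d.
  by move: (vpow1 2) (vpow1 (-1)) => u v; ring.
case=> supp0 [g0 [e0 g01]] [supp1 [g1 [e1 g11]]].
set w := a ++ (i, e) :: b.
have -> : ncomponents w = ncomponents (a ++ (i, ~~ e) :: b).
  by rewrite /w /ncomponents !braid_perm_cat !braid_perm_cons.
have sm := ncomponents_smooth a b i (~~ e).
have n0 := ncomponents_gt0 (a ++ b).
have n1 := ncomponents_gt0 (a ++ (i, ~~ e) :: b).
have E : P w = _ := homflypt_skein_sign hP a b i e.
move: (ncomponents _) (ncomponents _) sm n0 n1 supp0 e0 supp1 e1.
move=> n n' sm n0 n1 supp0 e0 supp1 e1.
have es : crossing_sign e = 1 \/ crossing_sign e = -1.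
  by case: (e); [left|right].
split.
  move=> j t; rewrite E !lcoefD lcoef_scaled_shift lcoef_monomM => P0.
  have: (P (a ++ b))@_(j - crossing_sign e)@_(t - 1) != 0 \/
        (P (a ++ (i, ~~ e) :: b))@_(j - 2 * crossing_sign e)@_t != 0.
    apply/orP; apply: contraNT P0; rewrite negb_or !negbK.
    by case/andP=> /eqP-> /eqP->; rewrite mulr0.
  by case=> [/supp0|/supp1] [*]; split; lia.
have Z : zpart (1 - n'%:Z) (P w) =
    vpow1 (crossing_sign e) * (crossing_sign e *: zpart (- n'%:Z) (P (a ++ b)))
  + vpow1 (2 * crossing_sign e) * zpart (1 - n'%:Z) (P (a ++ (i, ~~ e) :: b)).
  rewrite E zpartD !zpart_vpowM zpart_zpowZ.
  by have -> : 1 - n'%:Z - 1 = - n'%:Z by ring.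
case: sm => sm.
  exists (vpow1 (2 * crossing_sign e) * g1); split;
    last by rewrite eval1_vpow1M.
  rewrite Z e1 mulrCA (_ : zpart (- n'%:Z) _ = 0) ?scaler0 ?mulr0 ?add0r //.
  apply/laurentP=> j; rewrite zpartE lcoef0.
  by apply/eqP/negP=> /negP/supp0[]; lia.
exists (vpow1 (2 * crossing_sign e) * g1 +
  (1 - vpow1 2) * (vpow1 (crossing_sign e) * (crossing_sign e *: g0))); split.
  have e2 : (- n'%:Z = 1 - n%:Z) by lia.
  rewrite Z e1.
  have -> : zpart (- n'%:Z) (P (a ++ b)) =
      (1 - vpow1 2) * (1 - vpow1 2) ^+ n'.-1 * g0.
    by rewrite e2 e0 sm /= -exprS prednK.
  move: ((1 - vpow1 2) ^+ n'.-1) => d.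
  by case: es => ->; rewrite ?scale1r ?scaleN1r;
    move: (vpow1 2) (vpow1 _) (vpow1 _) => u v t; ring.
by rewrite eval1D eval1_vanish eval1_vpow1M g11 addr0.
Qed.
End Homflypt.

(** * Mirror images *)

Definition inverse_word k (u : braid_word k) : braid_word k := rev (mirror u).

Lemma mirror_cat k (a b : braid_word k) :
  mirror (a ++ b) = mirror a ++ mirror b.
Proof. exact: map_cat. Qed.

Lemma mirrorK k (u : braid_word k) : mirror (mirror u) = u.
Proof.
rewrite /mirror -map_comp -[RHS]map_id.
by apply: eq_map => -[i e] /=; rewrite negbK.
Qed.

Lemma inverse_wordK k (u : braid_word k) : inverse_word (inverse_word u) = u.
Proof. by rewrite /inverse_word {1}/mirror map_rev revK; apply: mirrorK. Qed.

Lemma iso_cancel_word k (a u b : braid_word k) :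
  isotopic_closures (a ++ u ++ inverse_word u ++ b) (a ++ b).
Proof.
elim/last_ind: u b => [|u [i e] IHu] b; first exact: iso_refl.
have -> : a ++ rcons u (i, e) ++ inverse_word (rcons u (i, e)) ++ b =
    (a ++ u) ++ [:: (i, e); (i, ~~ e)] ++ (inverse_word u ++ b).
  by rewrite /inverse_word /mirror map_rcons rev_rcons -cats1 -!catA.
by apply: iso_trans (iso_cancel _ _ _ _) _; rewrite -catA.
Qed.

(** Relations between positive words yield relations between their inverses,
    hence between their mirror images. *)
Lemma iso_inverse_word k (u v : braid_word k) :
    (forall a b, isotopic_closures (a ++ u ++ b) (a ++ v ++ b)) ->
  forall a b, isotopic_closures (a ++ inverse_word u ++ b)
                                (a ++ inverse_word v ++ b).
Proof.
move=> uv a b; set u' := inverse_word u; set v' := inverse_word v.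
apply: (@iso_trans _ _ _ _ ((a ++ u') ++ v ++ v' ++ b)).
  by rewrite catA; apply/iso_sym/iso_cancel_word.
apply: iso_trans (iso_sym (uv _ _)) _.
rewrite -catA -{1}(inverse_wordK u) -/u'; exact: iso_cancel_word.
Qed.

Lemma mirror_isotopy k l (a : braid_word k) (b : braid_word l) :
  isotopic_closures a b -> isotopic_closures (mirror a) (mirror b).
Proof.
elim=> {k l a b} [k a|k l a b _|k l m a b c _ ab _|k a b i e|k a b i j ij
  |k a b i j ij|k a b|k a e].
- exact: iso_refl.
- exact: iso_sym.
- exact: iso_trans ab.
- by rewrite !mirror_cat; apply: iso_cancel.
- rewrite !mirror_cat; apply: (@iso_inverse_word _
    [:: (j, true); (i, true)] [:: (i, true); (j, true)]).
  by move=> c d; apply/iso_sym/iso_commute.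
- rewrite !mirror_cat; apply: (@iso_inverse_word _
    [:: (i, true); (j, true); (i, true)] [:: (j, true); (i, true); (j, true)]).
  by move=> c d; apply: iso_braid.
- by rewrite !mirror_cat; apply: iso_conjugate.
- rewrite {2}/mirror map_rcons.
  have -> : map (fun s => (s.1, ~~ s.2)) (add_strand a) = add_strand (mirror a).
    by rewrite /add_strand /mirror -!map_comp.
  exact: iso_stabilise.
Qed.

Lemma ncomponents_mirror k (b : braid_word k) :
  ncomponents (mirror b) = ncomponents b.
Proof. by rewrite /ncomponents /braid_perm big_map. Qed.

Lemma writhe_mirror k (b : braid_word k) : writhe (mirror b) = - writhe b.
Proof.
rewrite /writhe big_map -sumrN.
by apply: eq_bigr => -[i []] _ //=; rewrite opprK.
Qed.

Section Homflypt.
Variables (P : forall k, braid_word k -> laurent2) (hP : is_homflypt P).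

(** The mirror image has polynomial P(1/v, -z).  As z occurs with exponents of
    the parity of mu - 1, the change of sign of z is a global sign. *)
Lemma homflypt_mirror k (w : braid_word k) i :
  (P (mirror w))@_i = (-1) ^+ (ncomponents w).-1 *: (P w)@_(- i).
Proof.
elim/skein_induction: w i => {k} [k l a b ab Pa||k a Pa|k a b j e Pab Pe] i.
- rewrite -(homflypt_isotopy hP (mirror_isotopy ab)).
  by rewrite -(homflypt_isotopy hP ab) -(ncomponents_isotopy ab).
- rewrite ncomponents_unknot expr0 scale1r (homflypt_unknot hP) -lmonom0.
  by rewrite !lmonomE oppr_eq0.
- have -> : mirror (add_strand a) = add_strand (mirror a).
    by rewrite /add_strand /mirror -!map_comp.
  have n0 := ncomponents_gt0 a.
  rewrite ncomponents_add_strand.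
  have E := congr1 (fun p => zpow (-1) * p@_(i + 1))
    (homflypt_add_strand hP (mirror a)).
  have E' := congr1 (fun p => zpow (-1) * p@_(- i + 1))
    (homflypt_add_strand hP a).
  move: E E'; rewrite !lcoefB !lcoef_monomM !lcoefZ !addrK !mulrA -lmonomD.
  rewrite addNr lmonom0 !mul1r => -> ->.
  rewrite !Pa.
  have -> : - (i + 1 - 2) = - i + 1 by ring.
  have -> : - (i + 1) = - i + 1 - 2 by ring.
  rewrite succnK -[in RHS](prednK n0) exprS -scalerA scaleN1r.
  rewrite -scalerBr -scalerN -mulrN opprB.
  by rewrite [LHS]mulrC laurent_scalerAl mulrC.
have -> : mirror (a ++ (j, e) :: b) = mirror a ++ (j, ~~ e) :: mirror b.
  exact: mirror_cat.
have cN : crossing_sign (~~ e) = - crossing_sign e by case: (e); rewrite ?opprK.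
have nE : ncomponents (a ++ (j, ~~ e) :: b) = ncomponents (a ++ (j, e) :: b).
  by rewrite /ncomponents !braid_perm_cat !braid_perm_cons.
rewrite (homflypt_skein_sign hP (mirror a)) (homflypt_skein_sign hP a).
rewrite cN !lcoefD !lcoef_monomM !lcoefZ -mirror_cat Pab negbK.
have -> : mirror a ++ (j, e) :: mirror b = mirror (a ++ (j, ~~ e) :: b).
  by rewrite mirror_cat /= negbK.
rewrite Pe nE scalerDr.
have -> : - (i - 2 * - crossing_sign e) = - i - 2 * crossing_sign e by ring.
have -> : - (i - - crossing_sign e) = - i - crossing_sign e by ring.
congr (_ + _); rewrite !laurent_scalerAl [zpow 1 * (_ *: _)]mulrC.
rewrite laurent_scalerAl !scalerA [_ * zpow 1]mulrC; congr (_ *: _).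
have n0 := ncomponents_gt0 (a ++ b).
have n1 := ncomponents_gt0 (a ++ (j, e) :: b).
have sgnS n : (0 < n)%N -> (-1) ^+ n.+1.-1 = - (-1) ^+ n.-1 :> int.
  by case: n => // n _; rewrite exprS mulN1r.
have [->|->] := ncomponents_smooth a b j e.
  by rewrite (sgnS _ n0) !mulNr mulrC.
by rewrite (sgnS _ n1) mulrNN mulrC.
Qed.
End Homflypt.

(** * Three proper polynomials *)

Lemma is_mfw_familyP k (b : braid_word k) p h :
  is_mfw_family b p h <-> forall i, p@_i =
    \sum_(0 <= j < k.+1) h j *+ (i == writhe b - k.+1%:Z + 1 + 2 * j%:Z).
Proof.
have E i : (vpow (writhe b - k.+1%:Z + 1)
      * \sum_(0 <= j < k.+1) h j *: vpow (2 * j%:Z))@_i =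
    \sum_(0 <= j < k.+1) h j *+ (i == writhe b - k.+1%:Z + 1 + 2 * j%:Z).
  rewrite lcoef_monomM lcoef_sum; apply: eq_bigr => j _.
  by rewrite lcoefZ lmonomE mulr_natr subr_eq [_ + (2 * _)]addrC.
split=> [->|H]; first exact: E.
by apply/laurentP=> i; rewrite E H.
Qed.

Section MFW.
Variables (k : nat) (b : braid_word k) (p : laurent2) (h : nat -> laurent1).
Hypothesis mfw : is_mfw_family b p h.
Let base := writhe b - k.+1%:Z + 1.

Lemma mfw_coef j : (j < k.+1)%N -> p@_(base + 2 * j%:Z) = h j.
Proof.
move=> jk; have /is_mfw_familyP-> := mfw.
under eq_bigr => i _.
  rewrite (_ : (_ == _) = (i == j)); last by rewrite /base; apply/eqP/eqP; lia.
  rewrite mulrb; over.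
by rewrite -big_mkcond /= big_nat1_eq jk.
Qed.

Lemma mfw_supp i : p@_i != 0 ->
  exists j, [/\ (j < k.+1)%N, i = base + 2 * j%:Z & h j != 0].
Proof.
move=> pi; have [|no] := boolP [exists j : 'I_k.+1, i == base + 2 * j%:Z].
  case/existsP=> j /eqP ei; exists j; split=> //.
  by rewrite -mfw_coef // -ei.
case/eqP: pi; have /is_mfw_familyP-> := mfw.
rewrite big_mkord big1 // => j _; case: eqP => // ei.
by case/existsP: no; exists j; apply/eqP.
Qed.

End MFW.

Section ThreeTerms.
Variables (P : forall k, braid_word k -> laurent2).
Variables (k : nat) (beta : braid_word k) (h : nat -> laurent1) (m M : nat).
Variables (zeta x y : int) (hbeta : bmin3 P beta h m M zeta x y).

Let base := writhe beta - k.+1%:Z + 1.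

Lemma bmin3_maxE : M = m.+2.
Proof. by have := bmin3_bmin hbeta; lia. Qed.

Lemma bmin3_xE : x = base + 2 * m%:Z.
Proof.
have mfw := bmin3_mfw hbeta.
have [mk hm hmin] := bmin3_min hbeta; have [px xmin] := bmin3_x hbeta.
have [j [jk xj hj]] := mfw_supp mfw px.
have := hmin _ jk hj; have := xmin (base + 2 * m%:Z).
rewrite (mfw_coef mfw mk) => /(_ hm); rewrite /base in xj *; lia.
Qed.

Lemma bmin3_yE : y = x + 4.
Proof.
have mfw := bmin3_mfw hbeta.
have [Mk hM hmax] := bmin3_max hbeta; have [py ymax] := bmin3_y hbeta.
have [j [jk yj hj]] := mfw_supp mfw py.
have := hmax _ jk hj; have := ymax (base + 2 * M%:Z).
rewrite (mfw_coef mfw Mk) => /(_ hM).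
have := bmin3_xE; have := bmin3_maxE; rewrite /base in yj *; lia.
Qed.

Lemma bmin3_three_terms :
  P beta = h m *: vpow x + h m.+1 *: vpow (x + 2) + h m.+2 *: vpow (x + 4).
Proof.
have mfw := bmin3_mfw hbeta; have xE := bmin3_xE; have ME := bmin3_maxE.
have [_ _ hmin] := bmin3_min hbeta; have [Mk _ hmax] := bmin3_max hbeta.
have m2k : (m.+2 < k.+1)%N by rewrite -ME.
have m1k : (m.+1 < k.+1)%N by lia.
have mk : (m < k.+1)%N by lia.
apply/laurentP=> i; rewrite !lcoefD !lcoefZ !lmonomE.
have [->|i0] := eqVneq i x.
  have -> : (x == x + 2) = false by lia.
  have -> : (x == x + 4) = false by lia.
  by rewrite mulr1 !mulr0 !addr0 xE (mfw_coef mfw).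
have [->|i2] := eqVneq i (x + 2).
  have -> : (x + 2 == x + 4) = false by lia.
  have -> : x + 2 = base + 2 * m.+1%:Z by lia.
  by rewrite mulr1 !mulr0 addr0 add0r (mfw_coef mfw).
have [->|i4] := eqVneq i (x + 4).
  have -> : x + 4 = base + 2 * m.+2%:Z by lia.
  by rewrite mulr1 !mulr0 !add0r (mfw_coef mfw).
rewrite !mulr0 !addr0; apply/eqP/negPn/negP=> /(mfw_supp mfw) [j [jk ij hj]].
have := hmin _ jk hj; have := hmax _ jk hj; rewrite -/base in ij; lia.
Qed.

End ThreeTerms.

Section FibRelations.
Variables (P : forall k, braid_word k -> laurent2) (hP : is_homflypt P).
Variables (k : nat) (beta : braid_word k) (a b c : laurent1) (x : int).
Hypothesis threeP :
  P beta = a *: vpow x + b *: vpow (x + 2) + c *: vpow (x + 4).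

Let three_fib s :
  a * fib (s - x) + b * fib (s - (x + 2)) + c * fib (s - (x + 4)) = fib s.
Proof.
rewrite -[RHS](homflypt_fib hP beta) threeP !lpairD !lpairZ.
by rewrite !lpair_monom.
Qed.

(** The instance s = x + 2 eliminates b, as F_0 = 0; likewise s = x and
    s = x + 4 below eliminate a and c. *)
Lemma coef_relation_ac t : a@_t = (fib (x + 2))@_(t + 1) + c@_t.
Proof.
rewrite -three_fib.
have -> : x + 2 - x = 2 by ring.
have -> : x + 2 - (x + 2) = 0 by ring.
have -> : x + 2 - (x + 4) = - 2%:Z by ring.
rewrite fibN [fib 2]/= [fib 0]/= [fibnat 2]/=.
have -> : a * (zpow 1 * 1 + 0) + b * 0 + c * ((-1) ^+ 3 * (zpow 1 * 1 + 0)) =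
  zpow 1 * a - zpow 1 * c by ring.
by rewrite lcoefB !lcoef_monomM addrK subrK.
Qed.

Lemma coef_relation_bc t :
  b@_t = - (fib x)@_(t + 1) - 2 * c@_t - c@_(t - 2).
Proof.
rewrite -three_fib.
have -> : x - x = 0 by ring.
have -> : x - (x + 2) = - 2%:Z by ring.
have -> : x - (x + 4) = - 4%:Z by ring.
rewrite !fibN [fib 0]/= [fibnat 2]/= [fibnat 4]/=.
set e := (X in _ = - X@__ - _ - _).
have -> : e = - (zpow 1 * b + zpow 1 * c *+ 2
                 + zpow 1 * (zpow 1 * (zpow 1 * c))).
  by rewrite /e; ring.
rewrite lcoefN !lcoefD !lcoef_monomM addrK.
have -> : t - 1 - 1 = t - 2 :> int by ring.
by ring.
Qed.

Lemma coef_relation_ba t :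
  b@_t = (fib (x + 4))@_(t + 1) - 2 * a@_t - a@_(t - 2).
Proof.
rewrite -three_fib.
have -> : x + 4 - x = 4 by ring.
have -> : x + 4 - (x + 2) = 2 by ring.
have -> : x + 4 - (x + 4) = 0 by ring.
rewrite [fib 0]/= [fib 2]/= [fib 4]/=.
set e := (X in _ = X@__ - _ - _).
have -> : e = zpow 1 * b + zpow 1 * a *+ 2 + zpow 1 * (zpow 1 * (zpow 1 * a)).
  by rewrite /e; ring.
rewrite !lcoefD !lcoef_monomM addrK.
have -> : t - 1 - 1 = t - 2 :> int by ring.
by ring.
Qed.

End FibRelations.

Lemma lcoef_fib_pos n i : 0 <= n ->
  (fib n)@_(n - 1 - 2 * i) = binz (n - 1 - i) i.
Proof. by case: n => // n _; apply: lcoef_fibnat. Qed.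

Lemma lcoef_fib_neg n i : 0 <= n ->
  (fib (- n))@_(n - 1 - 2 * i) = - ((-1) ^ n * binz (n - 1 - i) i).
Proof.
case: n => // n _; rewrite fibN lcoef_signM lcoef_fibnat.
by rewrite exprS mulN1r mulNr.
Qed.

(** Multiplication by 2 + z^2 is injective, because the top coefficient of a
    product with 2 + z^2 is that of the other factor. *)
Lemma vanishing_recurrence (d : int -> int) (zeta : int) :
    (forall t, zeta < t -> d t = 0) ->
    (forall j : int, 2 * d (zeta - 2 * j) + d (zeta - 2 - 2 * j) = 0) ->
  forall j : int, d (zeta - 2 * j) = 0.
Proof.
move=> dtop drec j; have [j0|j0] := ltrP j 0; first by apply: dtop; lia.
have -> : zeta - 2 * j = zeta + 2 - 2 * (`|j|.+1)%:Z by lia.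
elim: (`|j|.+1) => [|n IHn]; first by apply: dtop; lia.
have := drec (n%:Z - 1).
have -> : zeta - 2 * (n%:Z - 1) = zeta + 2 - 2 * n%:Z by ring.
have -> : zeta - 2 - 2 * (n%:Z - 1) = zeta + 2 - 2 * n.+1%:Z by lia.
by rewrite IHn mulr0 add0r.
Qed.

(** The common form of the relations in both cases: u is c in Case I and a in
    Case II, and w is b. *)
Lemma relations_determine (lo zeta : int) (A B : int -> int)
    (u v w u' v' w' : int -> int) :
  let vanishing (f : int -> int) := forall k, ~~ (lo <= k <= zeta) -> f k = 0 in
  let rel (u v w : int -> int) := forall j : int,
    v (zeta - 2 * j) = A j + u (zeta - 2 * j) /\
    w (zeta - 2 * j) = B j - 2 * u (zeta - 2 * j) - u (zeta - 2 - 2 * j) in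
  let same (f g : int -> int) :=
    forall j : int, f (zeta - 2 * j) = g (zeta - 2 * j) in
  vanishing u -> vanishing u' -> rel u v w -> rel u' v' w' ->
  same u u' \/ same v v' \/ same w w' ->
  [/\ same u u', same v v' & same w w'].
Proof.
move=> vanishing rel same vu vu' r r' sames.
have su : same u u'.
  case: sames => [//|[sv|sw]] j.
    by have [+ _] := r j; have [+ _] := r' j; have := sv j; lia.
  apply/eqP; rewrite -subr_eq0; apply/eqP; move: j.
  apply: (vanishing_recurrence (d := fun t => u t - u' t)).
    by move=> t zt; rewrite vu ?vu' ?subr0 //; lia.
  by move=> i; have [_ +] := r i; have [_ +] := r' i; have := sw i; lia.
split=> // j.
  by have [-> _] := r j; have [-> _] := r' j; rewrite su.
have [_ ->] := r j; have [_ ->] := r' j; rewrite su.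
have := su (j + 1).
have -> : zeta - 2 * (j + 1) = zeta - 2 - 2 * j by ring.
by lia.
Qed.

(** * The relations between the coefficients *)

Lemma halfz_double q : halfz (2 * q) = q.
Proof. by rewrite /halfz; lia. Qed.

Lemma halfzE n q : n = 2 * q -> halfz n = q.
Proof. by move->; apply: halfz_double. Qed.

Lemma lcoef1 i : (1 : laurent1)@_i = (i == 0)%:R.
Proof. by rewrite -lmonom0 lmonomE. Qed.

Lemma each_determines_I lo zeta x :
  case_I zeta x -> each_determines_others lo zeta (relations_I zeta x).
Proof.
move=> /andP[x2 xz] vanishing same a b c a' b' c' va vb vc.
move=> va' vb' vc' r r' sames.
pose A j := binz (halfz (zeta + x) + 1 - j) (j - halfz (zeta - x)).
pose B j := if 0 <= x then
    - binz (halfz (zeta + x) - j) (j - 1 - halfz (zeta - x))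
  else (-1) ^ x * kronecker j (halfz (1 + zeta)).
have norm f g e : relations_I zeta x f g e -> forall j : int,
   f (zeta - 2 * j) = A j + e (zeta - 2 * j) /\
   g (zeta - 2 * j) = B j - 2 * e (zeta - 2 * j) - e (zeta - 2 - 2 * j).
  move=> R j; have [-> R0 R1] := R j; split=> //; rewrite /B.
  by case: (lerP 0 x) => x0; [apply: R0|apply: R1; lia].
have [|? ? ?] := relations_determine vc vc' (norm _ _ _ r) (norm _ _ _ r').
  by case: sames => [?|[?|?]]; [right; left|right; right|left].
by split.
Qed.

Lemma each_determines_II lo zeta y :
  case_II zeta y -> each_determines_others lo zeta (relations_II zeta y).
Proof.
move=> /andP[y2 yz] vanishing same a b c a' b' c' va vb vc.
move=> va' vb' vc' r r' sames.
pose A j := (-1) ^ y * binz (halfz (zeta - y) + 1 - j) (j - halfz (zeta + y)).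
pose B j := if y <= 0 then
    - ((-1) ^ y * binz (halfz (zeta - y) - j) (j - 1 - halfz (zeta + y)))
  else kronecker j (halfz (1 + zeta)).
have norm f g e : relations_II zeta y f g e -> forall j : int,
   e (zeta - 2 * j) = A j + f (zeta - 2 * j) /\
   g (zeta - 2 * j) = B j - 2 * f (zeta - 2 * j) - f (zeta - 2 - 2 * j).
  move=> R j; have [R0 R1 ->] := R j; split=> //; rewrite /B.
  by case: (lerP y 0) => y0; [apply: R0|apply: R1; lia].
have [|? ? ?] := relations_determine va va' (norm _ _ _ r) (norm _ _ _ r').
  by case: sames => [?|[?|?]]; [left|right; right|right; left].
by split.
Qed.

Section Coefficients.
Variables (P : forall k, braid_word k -> laurent2) (hP : is_homflypt P).
Variables (k : nat) (beta : braid_word k) (a b c : laurent1) (x : int).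
Hypothesis threeP :
  P beta = a *: vpow x + b *: vpow (x + 2) + c *: vpow (x + 4).

Lemma three_terms_relations_I q : -2 <= x ->
  relations_I (x + 2 * q) x (lcoef a) (lcoef b) (lcoef c).
Proof.
move=> x2 j.
rewrite (@halfzE (x + 2 * q + x) (x + q)); last ring.
rewrite (@halfzE (x + 2 * q - x) q); last ring.
split=> [|x0|].
- rewrite (coef_relation_ac hP threeP).
  have -> : x + 2 * q - 2 * j + 1 = (x + 2) - 1 - 2 * (j - q) by ring.
  rewrite lcoef_fib_pos; last lia.
  by congr (binz _ _ + _); ring.
- rewrite (coef_relation_bc hP threeP).
  have -> : x + 2 * q - 2 * j + 1 = x - 1 - 2 * (j - 1 - q) by ring.
  rewrite lcoef_fib_pos //.
  have -> : x + 2 * q - 2 - 2 * j = x + 2 * q - 2 * j - 2 by ring.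
  by congr (- binz _ _ - _ - _); ring.
rewrite (coef_relation_bc hP threeP).
have -> : x + 2 * q - 2 - 2 * j = x + 2 * q - 2 * j - 2 by ring.
rewrite /kronecker; case=> ->; congr (_ - _ - _).
  have -> : fib (-1) = 1 by rewrite /= !mulr1.
  rewrite lcoef1 (@halfzE _ q); last ring.
  rewrite (_ : (_ == 0) = (j == q)); last by apply/eqP/eqP; lia.
  by rewrite expN1r; case: (j == q).
have -> : fib (-2) = - zpow 1 by rewrite /=; ring.
rewrite lcoefN lmonomE opprK (_ : (_ == 1) = (j == halfz (1 + (-2 + 2 * q)))).
  by rewrite expN1r mul1r; case: (j == _).
by rewrite /halfz; apply/eqP/eqP; lia.
Qed.

Lemma three_terms_relations_II q : x + 4 <= 2 ->
  relations_II (2 * q - (x + 4)) (x + 4) (lcoef a) (lcoef b) (lcoef c).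
Proof.
have [y ye] : exists y, y = x + 4 by exists (x + 4).
rewrite -ye => y2 j.
have sgn (n t : int) : (-1) ^ (n - t) = (-1) ^ (n + t) :> int.
  by rewrite !exprzDr ?unitrN1 // !expN1r abszN.
rewrite (@halfzE (2 * q - y - y) (q - y)); last ring.
rewrite (@halfzE (2 * q - y + y) q); last ring.
split=> [y0||].
- rewrite (coef_relation_ba hP threeP) -ye.
  have -> : fib y = fib (- - y) by rewrite opprK.
  have -> : 2 * q - y - 2 * j + 1 = - y - 1 - 2 * (j - 1 - q) by ring.
  rewrite lcoef_fib_neg; last by lia.
  have -> : 2 * q - y - 2 - 2 * j = 2 * q - y - 2 * j - 2 by ring.
  have := sgn 0 y; rewrite sub0r add0r => ->.
  by have -> : - y - 1 - (j - 1 - q) = q - y - j by ring.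
- rewrite (coef_relation_ba hP threeP) -ye.
  have -> : 2 * q - y - 2 - 2 * j = 2 * q - y - 2 * j - 2 by ring.
  rewrite /kronecker => ye1; case: ye1 => ->; congr (_ - _ - _).
    rewrite [fib 1]/= lcoef1 (@halfzE _ q); last ring.
    by rewrite (_ : (_ == 0) = (j == q)) //; apply/eqP/eqP; lia.
  have -> : fib 2 = zpow 1 by rewrite /= mulr1 addr0.
  rewrite lmonomE (_ : (_ == 1) = (j == halfz (1 + (2 * q - 2)))).
    by case: (j == _).
  by rewrite /halfz; apply/eqP/eqP; lia.
have := coef_relation_ac hP threeP (2 * q - y - 2 * j).
have -> : fib (x + 2) = fib (- (2 - y)) by congr fib; rewrite ye; ring.
have -> : 2 * q - y - 2 * j + 1 = (2 - y) - 1 - 2 * (j - q) by ring.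
rewrite lcoef_fib_neg; last by lia.
rewrite sgn exprzDr ?unitrN1 // (_ : (-1) ^ 2 = 1 :> int) // mul1r.
have -> : 2 - y - 1 - (j - q) = q - y + 1 - j by ring.
by move=> ->; ring.
Qed.

Lemma zpart_three_terms t : zpart t (P beta) =
  a@_t *: vpow1 x + b@_t *: vpow1 (x + 2) + c@_t *: vpow1 (x + 4).
Proof.
apply/laurentP=> i; rewrite zpartE threeP !lcoefD !lcoefZ !lmonomE.
by do 3!case: eqP => _; rewrite !(mulr1, mulr0, lcoefD, lcoef0).
Qed.

(** The coefficient of z^x in a - c is the leading coefficient of F_(x+2) when
    x >= -1; when x <= -3, the leading coefficient of F_(-x-2) is, up to sign,
    the coefficient of z^(-x-4). *)
Lemma three_terms_cases zeta : 0 <= zeta ->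
    (forall t, zeta < t -> a@_t = 0 /\ c@_t = 0) ->
  case_I zeta x \/ case_II zeta (x + 4).
Proof.
move=> z0 top; rewrite /case_I /case_II.
have [x2|x2] := lerP (- 1) x.
  left; apply/andP; split; first lia.
  case: lerP => // /top[ax cx].
  have := coef_relation_ac hP threeP x; rewrite ax cx addr0.
  have -> : x + 1 = (x + 2) - 1 - 2 * 0 by ring.
  rewrite lcoef_fib_pos; last lia.
  rewrite subr0; have : 0 <= x + 2 - 1 by lia.
  by case: (x + 2 - 1) => // n _; rewrite /binz /= bin0.
have [xe|x3] := eqVneq x (- 2); first by left; rewrite xe; lia.
right; apply/andP; split; first lia.
case: lerP => // /top[ax cx].
have := coef_relation_ac hP threeP (- (x + 4)); rewrite ax cx addr0.
have -> : fib (x + 2) = fib (- (- x - 2)) by congr fib; ring.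
have -> : - (x + 4) + 1 = (- x - 2) - 1 - 2 * 0 by ring.
rewrite lcoef_fib_neg; last lia.
rewrite subr0; have : 0 <= - x - 2 - 1 by lia.
case: (- x - 2 - 1) => // n _; rewrite /binz /= bin0 mulr1 expN1r => /eqP.
by rewrite eq_sym oppr_eq0 signr_eq0.
Qed.

End Coefficients.

(** A 2-periodic family of coefficients with finite support is zero. *)
Lemma vanishing_mul1Bv f : (1 - vpow1 2) * f = 0 -> f = 0.
Proof.
move=> f0; have per i : f@_i = f@_(i - 2).
  have := congr1 (fun p => p@_i) f0.
  rewrite mulrBl mul1r lcoefB lcoef_monomM lcoef0; move/eqP.
  by rewrite subr_eq0 => /eqP.
apply/laurentP=> i; rewrite lcoef0; apply/eqP/negPn/negP=> fi.
have all_i n : f@_(i - 2 * n%:Z) = f@_i.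
  elim: n => [|n <-]; first by rewrite mulr0 subr0.
  by rewrite [in RHS]per; congr lcoef; lia.
pose g (n : 'I_(#|` finsupp f|).+1) := i - 2 * (nat_of_ord n)%:Z.
have ginj : injective g.
  by move=> u v; rewrite /g => e; apply: val_inj; move: e => /= e; lia.
have : (size (map g (enum 'I_(#|` finsupp f|).+1)) <= size (finsupp f))%N.
  apply: uniq_leq_size; first by rewrite map_inj_uniq ?enum_uniq.
  by move=> _ /mapP[n _ ->]; rewrite mem_finsupp -/(lcoef _ _) /g all_i.
by rewrite size_map size_enum_ord ltnn.
Qed.

(** A quotient by 1 - v^2 has one term less.  After two divisions the single
    term A v^x is left; it is g when n = 2, and a third division would make it
    zero. *)
Lemma three_terms_divisible n (A B C x : int) (g : laurent1) :
    A *: vpow1 x + B *: vpow1 (x + 2) + C *: vpow1 (x + 4) =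
      (1 - vpow1 2) ^+ n * g ->
    eval1 g = 1 ->
  (n <= 2)%N /\ (n = 2%N -> [/\ A = 1, B = -2 & C = 1]).
Proof.
have divide q (A' B' C' : int) :
    A' *: vpow1 x + B' *: vpow1 (x + 2) + C' *: vpow1 (x + 4) =
      (1 - vpow1 2) ^+ q.+1 * g ->
    A' + B' + C' = 0 /\
    A' *: vpow1 x + (A' + B') *: vpow1 (x + 2) + 0 *: vpow1 (x + 4) =
      (1 - vpow1 2) ^+ q * g.
  rewrite exprS -mulrA => E.
  have s0 : A' + B' + C' = 0.
    have := congr1 eval1 E.
    by rewrite eval1_vanish /eval1 !lpairD !lpairZ !lpair_monom !mulr1.
  split=> //; apply/eqP; rewrite -subr_eq0; apply/eqP/vanishing_mul1Bv.
  rewrite mulrBr -E.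
  have -> : C' = - (A' + B') by rewrite -[RHS]addr0 -s0; ring.
  have v2 : vpow1 (x + 2) = vpow1 2 * vpow1 x by rewrite addrC; apply: lmonomD.
  have v4 : vpow1 (x + 4) = vpow1 2 * (vpow1 2 * vpow1 x).
    by rewrite -v2 -[RHS]lmonomD; congr lmonom; ring.
  have S (d : int) (f : laurent1) : d *: f = (d *: (1 : laurent1)) * f.
    by rewrite laurent_scalerAl mul1r.
  rewrite v2 v4 scale0r addr0 scaleNr !scalerDl.
  rewrite !(S _ (_ * _)) !(S _ (vpow1 x)).
  move: (A' *: (1 : laurent1)) (B' *: (1 : laurent1)) => d e.
  by move: (vpow1 2) (vpow1 x) => u v; ring.
case: n => [|n] // E g1; have [s0 {}E] := divide _ _ _ _ E.
case: n E => [|n] // E; have [s1 {}E] := divide _ _ _ _ E.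
case: n E => [|n] E; last first.
  have [s2 _] := divide _ _ _ _ E; exfalso.
  have A0 : A = 0 by lia.
  have B0 : B = 0 by lia.
  move: E; rewrite A0 B0 !addr0 !scale0r !addr0 => /esym.
  elim: n.+1 => [|q IHq]; last by rewrite exprS -mulrA => /vanishing_mul1Bv.
  rewrite expr0 mul1r => g0; move: g1.
  by rewrite g0 -(scale0r (1 : laurent1)) /eval1 lpairZ mul0r.
split=> // _; have := congr1 eval1 E.
rewrite expr0 mul1r g1 /eval1 !lpairD !lpairZ !lpair_monom; split; lia.
Qed.

Lemma expands_downP (zeta : int) (N : nat) (f : laurent1) :
    (forall t, f@_t != 0 ->
       exists2 s : nat, (s <= N)%N & t = zeta - 2 * s%:Z) ->
  expands_down zeta N f.
Proof.
move=> supp; apply/laurentP=> t; rewrite lcoef_sum.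
under eq_bigr => s _ do rewrite lcoefZ lmonomE mulr_natr.
have [f0|/supp[s0 s0N ->]] := eqVneq (f@_t) 0.
  rewrite f0 big1 // => s _; case: eqP => [<-|_]; last by rewrite mulr0n.
  by rewrite f0 mul0rn.
under eq_bigr => s _.
  rewrite (_ : (_ == _) = (s == s0)); last by apply/eqP/eqP; lia.
  rewrite mulrb; over.
by rewrite -big_mkcond /= big_nat1_eq ltnS s0N.
Qed.

(** The linear identities given by the Fibonacci polynomials depend on x
    alone. *)
Lemma three_terms_unique (P : forall k, braid_word k -> laurent2)
    (hP : is_homflypt P) (k k' : nat) (beta : braid_word k)
    (beta' : braid_word k') (a b c a' b' c' : laurent1) (x zeta : int) :
    P k beta = a *: vpow x + b *: vpow (x + 2) + c *: vpow (x + 4) ->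
    P k' beta' = a' *: vpow x + b' *: vpow (x + 2) + c' *: vpow (x + 4) ->
    (forall t, zeta < t -> c@_t = 0) -> (forall t, zeta < t -> c'@_t = 0) ->
    a = a' \/ b = b' \/ c = c' ->
  P k beta = P k' beta'.
Proof.
move=> E E' top top' same.
have ac := coef_relation_ac hP E; have ac' := coef_relation_ac hP E'.
have bc := coef_relation_bc hP E; have bc' := coef_relation_bc hP E'.
suff cc : c = c'.
  have aa : a = a' by apply/laurentP=> t; rewrite ac ac' cc.
  have bb : b = b' by apply/laurentP=> t; rewrite bc bc' cc.
  by rewrite E aa bb cc -E'.
case: same => [aa|[bb|//]]; apply/laurentP=> t.
  by have := ac t; have := ac' t; rewrite aa; lia.
apply/eqP; rewrite -subr_eq0; apply/eqP.
have vanish z : zeta <= z -> forall j, c@_(z - 2 * j) - c'@_(z - 2 * j) = 0.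
  move=> zz; apply: (vanishing_recurrence (d := fun t => c@_t - c'@_t)).
    by move=> s zs; rewrite top ?top' ?subr0 //; lia.
  move=> j; have := bc (z - 2 * j); have := bc' (z - 2 * j); rewrite bb.
  have -> : z - 2 * j - 2 = z - 2 - 2 * j by ring.
  by lia.
have := vanish (t + 2 * `|zeta - t|%:Z) _ `|zeta - t|%:Z.
by rewrite addrK; apply; lia.
Qed.

Lemma bmin3_mirror (P : forall k, braid_word k -> laurent2)
    (hP : is_homflypt P) (k : nat) (beta : braid_word k)
    (h : nat -> laurent1) (m M : nat) (zeta x y : int) :
    bmin3 P beta h m M zeta x y ->
  bmin3 P (mirror beta)
    (fun j => (-1) ^+ (ncomponents beta).-1 *: h (k - j)%N) (k - M) (k - m)
    zeta (- y) (- x).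
Proof.
move=> hbeta; have ME := bmin3_maxE hbeta.
have mir := homflypt_mirror hP beta.
set s := (-1) ^+ (ncomponents beta).-1 in mir *.
have s0 : s != 0 by rewrite signr_eq0.
have ss : s * s = 1 by rewrite -expr2 sqrr_sign.
have scale0 (f : laurent1) : (s *: f != 0) = (f != 0).
  congr negb; apply/eqP/eqP=> [sf|->]; last by rewrite scaler0.
  by rewrite -[f]scale1r -ss -scalerA sf scaler0.
case: hbeta => mfw [mk hm hmin] [Mk hM hmax] hMm [[i0 pz] zmax].
move=> [px xmin] [py ymax] gt.
split.
- apply/is_mfw_familyP=> i; have /is_mfw_familyP E := mfw.
  rewrite mir E scaler_sumr big_nat_rev /= add0n.
  rewrite !big_nat; apply: eq_bigr => j /= jk.
  rewrite subSS -scalerMnr writhe_mirror; congr (_ *+ nat_of_bool _).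
  by apply/eqP/eqP; lia.
- split; [lia|by rewrite scale0 subKn //; lia|].
  by move=> j jk; rewrite scale0 => hj; have := hmax (k - j)%N; rewrite hj; lia.
- split; [lia|by rewrite scale0 subKn //; lia|].
  by move=> j jk; rewrite scale0 => hj; have := hmin (k - j)%N; rewrite hj; lia.
- by lia.
- split; first by exists (- i0); rewrite mir opprK lcoefZ mulf_neq0.
  move=> t [i]; rewrite mir lcoefZ mulf_eq0 negb_or => /andP[_ nz].
  by apply: zmax; exists (- i).
- split; first by rewrite mir opprK scale0.
  by move=> i; rewrite mir scale0 => /ymax; lia.
- split; first by rewrite mir opprK scale0.
  by move=> i; rewrite mir scale0 => /xmin; lia.
by rewrite ncomponents_mirror.
Qed.

Lemma three_terms_coef (a b c : laurent1) (x : int) (p : laurent2) :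
    p = a *: vpow x + b *: vpow (x + 2) + c *: vpow (x + 4) ->
  [/\ p@_x = a, p@_(x + 2) = b & p@_(x + 4) = c].
Proof.
have neq i j : i != j -> x + i == x + j = false.
  by move=> ij; apply/negbTE; apply: contra ij => /eqP/addrI->.
move=> ->; rewrite !lcoefD !lcoefZ !lmonomE !eqxx !neq //.
have -> : (x == x + 2) = false by lia.
have -> : (x == x + 4) = false by lia.
have -> : (x + 2 == x) = false by lia.
have -> : (x + 4 == x) = false by lia.
by rewrite !mulr0 !mulr1 !addr0 !add0r.
Qed.

Lemma laurent_neq0 (f : laurent1) : f != 0 -> exists t, f@_t != 0.
Proof.
have [f0|[t]] := fset_0Vmem (finsupp f); last first.
  by rewrite mem_finsupp; exists t.
case/eqP; apply/laurentP=> i; rewrite lcoef0 /lcoef fsfun_dflt //.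
by rewrite f0 inE.
Qed.

Lemma three_terms_factor (A B C x : int) :
  A *: vpow1 x + B *: vpow1 (x + 2) + C *: vpow1 (x + 4) =
  vpow1 x * (A *: vpow1 0 + B *: vpow1 2 + C *: vpow1 4).
Proof.
rewrite mulrC !mulrDl !laurent_scalerAl /vpow1 -!lmonomD.
by rewrite add0r ![_ + x]addrC.
Qed.

(** The relation for j = -1 gives b_(zeta+2), which vanishes. *)
Lemma relations_I_top (zeta x : int) (a b c : int -> int) :
    case_I zeta x -> 0 <= zeta -> (2 %| zeta - x)%Z ->
    relations_I zeta x a b c -> b (zeta + 2) = 0 -> c (zeta + 2) = 0 ->
  c zeta = 0.
Proof.
move=> /andP[x2 xz] z0 xpar R b0 c0.
have [_ R0 R1] := R (-1); move: R0 R1.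
have -> : zeta - 2 * -1 = zeta + 2 by ring.
have -> : zeta - 2 - 2 * -1 = zeta by ring.
rewrite b0 c0 binz_small; last by rewrite /halfz; lia.
rewrite /kronecker (_ : (_ == _) = false); last by rewrite /halfz; lia.
rewrite mulr0 => R0 R1; have [/R0|x0] := lerP 0 x; first by lia.
have /R1 : x = -1 \/ x = -2 by lia.
by lia.
Qed.

(** Here a_zeta is the binomial coefficient at j = 0, whose lower index is
    - (zeta - x) / 2; it is nonzero for zeta = x only.  The hypothesis on
    zeta = 0 excludes x = -2, where b_zeta = 1. *)
Lemma relations_I_extremal (zeta x : int) (a b c : int -> int) :
    case_I zeta x -> 0 <= zeta -> (2 %| zeta - x)%Z ->
    relations_I zeta x a b c -> c zeta = 0 -> c (zeta - 2) = 0 ->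
    (zeta = 0 -> x = 0) -> (b zeta = 0 -> a zeta != 0) ->
  [/\ zeta = x, a zeta = 1, a (zeta - 2) = zeta & b zeta = 0].
Proof.
move=> /andP[x2 xz] z0 xpar R cz cz2 zx0 ba; have [Ra R0 R1] := R 0.
move: Ra R0 R1; rewrite mulr0 !subr0 cz cz2 addr0 => Ra R0 R1.
have bz : b zeta = 0.
  have [x0|x0] := lerP 0 x.
    by rewrite R0 // binz_small; [lia|rewrite /halfz; lia].
  have z1 : zeta <> 0 by move/zx0; lia.
  rewrite R1 /kronecker; last by lia.
  by rewrite (_ : (_ == _) = false) ?mulr0 //; rewrite /halfz; lia.
have zx : zeta = x.
  apply/eqP/negPn/negP=> zx; case/eqP: (ba bz); rewrite Ra binz_small //.
  by rewrite /halfz; lia.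
have hx : halfz (zeta + x) = x by apply: halfzE; lia.
have h0 : halfz (zeta - x) = 0 by apply: halfzE; lia.
split=> //.
  rewrite Ra hx h0; have : 0 <= x by lia.
  by case: (x) => // n _; rewrite /binz /= bin0.
have [Ra1 _ _] := R 1; move: Ra1.
rewrite mulr1 cz2 addr0 hx h0 addrK subr0 => ->.
have : 0 <= x by lia.
by rewrite zx; case: (x) => // -[|n] _; rewrite /binz //= bin1.
Qed.

(** At z^-1 the binomial coefficients are of the form C(n, n); for x = -1 the
    second one is replaced by a Kronecker symbol with equal indices. *)
Lemma relations_I_at_m1 (zeta x : int) (a b c : int -> int) :
    case_I zeta x -> (2 %| zeta - x)%Z -> (2 %| x + 1)%Z ->
    relations_I zeta x a b c -> c (-3) = 0 ->
  a (-1) = 1 + c (-1) /\ b (-1) = - (1 + 2 * c (-1)).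
Proof.
move=> /andP[x2 xz] xpar xodd R c3.
have [q zq] : exists q, zeta = x + 2 * q by exists ((zeta - x) %/ 2)%Z; lia.
have [r xr] : exists r, x = 2 * r - 1 by exists ((x + 1) %/ 2)%Z; lia.
have binzz n : 0 <= n -> binz n n = 1.
  by case: n => // n _; rewrite /binz /= binn; case: ifP => //; lia.
have hp : halfz (zeta + x) = x + q by apply: halfzE; lia.
have hm : halfz (zeta - x) = q by apply: halfzE; lia.
have hz : halfz (1 + zeta) = r + q by apply: halfzE; lia.
have [Ra R0 R1] := R (r + q); move: Ra R0 R1; rewrite hp hm hz.
have -> : zeta - 2 * (r + q) = -1 by lia.
have -> : zeta - 2 - 2 * (r + q) = -3 by lia.
have -> : x + q + 1 - (r + q) = r by lia.
have -> : r + q - q = r by lia.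
have -> : x + q - (r + q) = r - 1 by lia.
have -> : r + q - 1 - q = r - 1 by lia.
rewrite c3 binzz; last by lia.
move=> a1 R0 R1; split=> //.
have [x0|x0] := lerP 0 x; first by rewrite R0 // binzz; lia.
have x1 : x = -1 by lia.
have -> := R1 (or_introl x1).
by rewrite x1 expN1r /kronecker eqxx /=; ring.
Qed.

Theorem theorem2p10
  (P : forall k, braid_word k -> laurent2) (hP : is_homflypt P)
  (k : nat) (beta : braid_word k) (h : nat -> laurent1) (m M : nat)
  (zeta x y : int) (hbeta : bmin3 P beta h m M zeta x y) :
  let mu := ncomponents beta in
  let a := lcoef (h m) in
  let b := lcoef (h m.+1) in
  let c := lcoef (h m.+2) in
  (* the expansions (i), (ii), (iii) *)
  (exists N : nat,
    [/\ zeta - 2 * N%:Z = 1 - mu%:Z,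
        expands_down zeta N (h m),
        expands_down zeta N (h m.+1)
      & expands_down zeta N (h m.+2)])
  (* so that (zeta +- x) / 2 and (zeta +- y) / 2 are integers *)
  /\ ((2 %| zeta - x)%Z /\ (2 %| zeta - y)%Z)
  /\ ((mu <= 3)%N /\ 0 <= zeta)
  (* zeta, x, one proper h_J and J - m determine P *)
  /\ (forall (k' : nat) (beta' : braid_word k') (h' : nat -> laurent1)
        (m' M' : nat) (y' : int), bmin3 P beta' h' m' M' zeta x y' ->
      forall J J' : nat, (m <= J <= m.+2)%N -> (m' <= J' <= m'.+2)%N ->
      (J - m = J' - m')%N -> h J = h' J' -> P k beta = P k' beta')
  /\ (mu = 3%N ->
      zpart (-2) (P k beta) = vpow1 x * (1 - vpow1 2) ^+ 2)
  /\ (case_I zeta x \/ case_II zeta y)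
  /\ (case_I zeta x ->
      [/\ c zeta = 0,
          c (zeta - 2) = 0 ->
            [/\ zeta = x, a zeta = 1, a (zeta - 2) = zeta & b zeta = 0],
          mu = 2%N ->
            zpart (-1) (P k beta) =
              vpow1 x * ((1 + c (-1)) *: vpow1 0 - (1 + 2 * c (-1)) *: vpow1 2
                          + c (-1) *: vpow1 4),
          relations_I zeta x a b c
        & each_determines_others (1 - mu%:Z) zeta (relations_I zeta x)])
  /\ (case_II zeta y ->
      relations_II zeta y a b c
      /\ each_determines_others (1 - mu%:Z) zeta (relations_II zeta y))
  (* mirror images exchange Case I, where zeta >= x >= -2, and Case II, where
     zeta >= - y >= -2 *)
  /\ (exists (h' : nat -> laurent1) (m' M' : nat),
      bmin3 P (mirror beta) h' m' M' zeta (- y) (- x)).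
Proof.
move=> mu a b c.
have three : P k beta =
    h m *: vpow x + h m.+1 *: vpow (x + 2) + h m.+2 *: vpow (x + 4).
  exact: bmin3_three_terms hbeta.
have yE := bmin3_yE hbeta.
have [supp [g [low g1]]] := homflypt_lowest_term hP beta.
rewrite -/mu in supp low.
have mu0 : (0 < mu)%N := ncomponents_gt0 beta.
have [[i0 pz] zmax] := bmin3_zeta hbeta.
have zmu : zeta > 1 - mu%:Z := bmin3_gt hbeta.
have [Px Px2 Px4] := three_terms_coef three.
pose in_range t :=
  [/\ 1 - mu%:Z <= t, t <= zeta & (2 %| t - (1 - mu%:Z))%Z].
have range i t : (P k beta)@_i@_t != 0 -> in_range t.
  move=> nz; have [? ? _] := supp _ _ nz; split=> //.
  by apply: zmax; exists i.
have ra t : a t != 0 -> in_range t by rewrite /a -Px; apply: range.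
have rb t : b t != 0 -> in_range t by rewrite /b -Px2; apply: range.
have rc t : c t != 0 -> in_range t by rewrite /c -Px4; apply: range.
have vanish (f : int -> int) : (forall t, f t != 0 -> in_range t) ->
    forall t, ~~ (1 - mu%:Z <= t <= zeta) -> f t = 0.
  by move=> rf t; apply: contraNeq => /rf[? ? _]; apply/andP.
have va := vanish _ ra; have vb := vanish _ rb; have vc := vanish _ rc.
have [_ _ zpar] := range _ _ pz.
have xpar : (2 %| zeta - x)%Z.
  have [px _] := bmin3_x hbeta; have [t pt] := laurent_neq0 px.
  by have [_ _ ?] := supp _ _ pt; lia.
have E := low; rewrite (zpart_three_terms three) in E.
have [mu2 muC] := three_terms_divisible E g1.
have mu3 : (mu <= 3)%N by lia.
have z0 : 0 <= zeta by lia.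
have cases : case_I zeta x \/ case_II zeta y.
  rewrite yE; apply: (three_terms_cases hP three z0) => t zt.
  by split; [apply: va|apply: vc]; lia.
have [q zq] : exists q, zeta = x + 2 * q by exists ((zeta - x) %/ 2)%Z; lia.
have relI : case_I zeta x -> relations_I zeta x a b c.
  by move=> /andP[x2 _]; rewrite zq; apply: (three_terms_relations_I hP three).
have relII : case_II zeta y -> relations_II zeta y a b c.
  move=> /andP[y2 _]; rewrite yE.
  have -> : zeta = 2 * (x + 2 + q) - (x + 4) by lia.
  by apply: (three_terms_relations_II hP three); lia.
have abc_mu3 : mu = 3%N -> [/\ a (-2) = 1, b (-2) = -2 & c (-2) = 1].
  by move=> m3; have := muC; rewrite m3 => /(_ erefl).
split.
  exists `|((zeta - (1 - mu%:Z)) %/ 2)%Z|%N.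
  have exps f : (forall t, f@_t != 0 -> in_range t) ->
      expands_down zeta `|((zeta - (1 - mu%:Z)) %/ 2)%Z|%N f.
    move=> rf; apply: expands_downP => t /rf[t1 t2 t3].
    by exists `|((zeta - t) %/ 2)%Z|%N; lia.
  by split; [lia|apply: exps|apply: exps|apply: exps].
split; first by split=> //; lia.
split; first by [].
split.
  move=> k' beta' h' m' M' y' hbeta' J J' mJ mJ' JJ hJ.
  have three' := bmin3_three_terms hbeta'.
  have [_ _ Px4'] := three_terms_coef three'.
  have [_ zmax'] := bmin3_zeta hbeta'.
  apply: (three_terms_unique hP three three' (zeta := zeta)).
  - by move=> t zt; apply: vc; lia.
  - move=> t zt; apply/eqP/negPn/negP=> ct.
    have : t <= zeta by apply: zmax'; exists (x + 4); rewrite Px4'.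
    by lia.
  have : J = m /\ J' = m' \/ J = m.+1 /\ J' = m'.+1 \/ J = m.+2 /\ J' = m'.+2.
    by lia.
  by case=> [[e e']|[[e e']|[e e']]]; move: hJ; rewrite e e' => ->;
    [left|right; left|right; right].
split.
  move=> m3; have [a1 b1 c1] := abc_mu3 m3.
  rewrite (zpart_three_terms three) -/(a _) -/(b _) -/(c _) a1 b1 c1.
  rewrite three_terms_factor !scale1r scaleNr scaler_nat.
  have -> : vpow1 4 = vpow1 2 * vpow1 2 by rewrite -[RHS]lmonomD.
  by rewrite [vpow1 0]lmonom0; move: (vpow1 2) (vpow1 x) => u v; ring.
split; first exact: cases.
split.
  move=> cI; have R := relI cI; have /andP[x2 xz] := cI.
  have cz : c zeta = 0.
    by apply: (relations_I_top cI z0 xpar R); [apply: vb|apply: vc]; lia.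
  split=> //.
  - move=> cz2; apply: (relations_I_extremal cI z0 xpar R cz cz2).
      (* zeta = 0 > x forces mu = 3, and then c_-2 = 1 *)
      move=> ze; have [//|x0] := eqVneq x 0; have m3 : mu = 3%N by lia.
      by have [_ _] := abc_mu3 m3; move: cz2; rewrite ze sub0r => ->.
    move=> bz; apply: contra_neq pz => az.
    rewrite three !lcoefD !lcoefZ !lmonomE.
    by do 3!case: eqP => _; rewrite ?(mulr1, mulr0, lcoefD, lcoef0)
      -/(a _) -/(b _) -/(c _) ?az ?bz ?cz.
  - move=> m2; have [||a1 b1] := relations_I_at_m1 cI xpar _ R.
    + by lia.
    + by apply: vc; lia.
    rewrite (zpart_three_terms three) three_terms_factor.
    by rewrite -/(a _) -/(b _) -/(c _) a1 b1 scaleNr.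
  exact: each_determines_I.
split.
  by move=> cII; split; [apply: relII|apply: each_determines_II].
by do 3!eexists; apply: bmin3_mirror hbeta.
Qed.
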